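(* Let $n\ge2$ and let $\Psi$ be an automorphism of the group $\mathrm{Aut}^\infty(\sigma_n)$. Let $\varphi \in\mathrm{Aut}^\infty(\sigma_n)$ be an element of (finite) order $k$ for which all orbits of $\varphi$ on $X_n$ have size $k$. Then $\Psi(\varphi)$ has the same property, i.e. $\Psi(\varphi)$ has order $k$ and all its orbits on $X_n$ have size $k$.
   Context: $X_n=\{0,\dots,n-1\}^{\mathbb{Z}}$ with the product topology, $\sigma_n$ is the shift $(\sigma_n(x))_i=x_{i+1}$. $\mathrm{Aut}^\infty(\sigma_n)$ is the group of all homeomorphisms $\varphi\colon X_n\to X_n$ with $\varphi\circ\sigma_n^k=\sigma_n^k\circ\varphi$ for some $k\ge1$. *)

(* Defs.v *)
From HB Require Import structures.
From mathcomp Require Import all_boot all_order all_algebra.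
From mathcomp Require Import monoid.
From mathcomp Require Import boolp classical_sets functions cardinality.
From mathcomp Require Import topology.

Set Implicit Arguments.
Unset Strict Implicit.
Unset Printing Implicit Defensive.

Import GRing.Theory.
Local Open Scope classical_set_scope.
Local Open Scope card_scope.

Definition homeomorphism (T U : topologicalType) (f : T -> U) : Prop :=
  continuous f /\ exists g : U -> T, [/\ continuous g, cancel f g & cancel g f].

Definition fullshift (n : nat) : Type := {ptws int -> discrete_topology 'I_n}.

HB.instance Definition _ n := Topological.copy (fullshift n)
  {ptws int -> discrete_topology 'I_n}.

Definition shift (n : nat) (x : fullshift n) : fullshift n :=
  fun i : int => x (i + 1)%R.

Definition is_autinf (n : nat) (f : fullshift n -> fullshift n) : Prop :=
  homeomorphism f /\
  exists2 k, (0 < k)%N &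
    f \o iter k (@shift n) = iter k (@shift n) \o f.

Record autinf (n : nat) := Autinf {
  autinf_fun :> fullshift n -> fullshift n;
  autinf_funP : `[< is_autinf autinf_fun >] }.

HB.instance Definition _ n := [isSub for @autinf_fun n].
HB.instance Definition _ n := [Choice of autinf n by <:].

Lemma autinfP n (f : autinf n) : is_autinf f.
Proof. exact/asboolP/autinf_funP. Qed.

Lemma autinf_eqP n (f g : autinf n) : f =1 g -> f = g.
Proof. by move=> fg; apply/val_inj/funext. Qed.

Lemma is_autinf_id n : is_autinf (@id (fullshift n)).
Proof.
split; last by exists 1%N.
by split; [|exists id; split=> //]; move=> x; exact: cvg_id.
Qed.

Lemma is_autinf_comp n (f g : fullshift n -> fullshift n) :
  is_autinf f -> is_autinf g -> is_autinf (f \o g).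
Proof.
move=> [[cf [f' [cf' fK f'K]]] [k k0 fk]] [[cg [g' [cg' gK g'K]]] [l l0 gl]].
have iterC (h : fullshift n -> fullshift n) a b :
    h \o iter a (@shift n) = iter a (@shift n) \o h ->
    h \o iter (b * a) (@shift n) = iter (b * a) (@shift n) \o h.
  move=> ha; elim: b => [|b IHb]; first by rewrite mul0n.
  apply/funext => x /=; rewrite mulSn !iterD.
  have := congr1 (@^~ (iter (b * a) (@shift n) x)) ha; rewrite /= => ->.
  by have := congr1 (@^~ x) IHb; rewrite /= => ->.
split.
  split; first by move=> x; apply: continuous_comp; [exact: cg|exact: cf].
  exists (g' \o f'); split.
  - by move=> x; apply: continuous_comp; [exact: cf'|exact: cg'].
  - exact: can_comp.
  - exact: can_comp.
exists (l * k)%N; first by rewrite muln_gt0 l0.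
have fkl := iterC _ _ l fk; have := iterC _ _ k gl; rewrite mulnC => glk.
by rewrite -compA glk compA fkl.
Qed.

Lemma autinf_inv_subproof n (f : autinf n) :
  exists g : autinf n, cancel f g /\ cancel g f.
Proof.
have [[cf [g [cg fK gK]]] [k k0 fk]] := autinfP f.
have gP : `[< is_autinf g >].
  apply/asboolP; split; first by split=> //; exists f.
  exists k => //; apply/funext => x /=.
  by apply: (can_inj fK); have := congr1 (@^~ (g x)) fk; rewrite /= !gK.
by exists (Autinf gP).
Qed.

Definition autinf_one n : autinf n := Autinf (asboolT (@is_autinf_id n)).

Definition autinf_mul n (f g : autinf n) : autinf n :=
  Autinf (asboolT (is_autinf_comp (autinfP f) (autinfP g))).

Definition autinf_inv n (f : autinf n) : autinf n :=
  projT1 (cid (autinf_inv_subproof f)).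

Lemma autinf_funK n (f : autinf n) : cancel f (autinf_inv f).
Proof. by rewrite /autinf_inv; case: cid => g []. Qed.

Lemma autinf_invK n (f : autinf n) : cancel (autinf_inv f) f.
Proof. by rewrite /autinf_inv; case: cid => g []. Qed.

Lemma autinf_mulA n : associative (@autinf_mul n).
Proof. by move=> f g h; exact: autinf_eqP. Qed.

Lemma autinf_mul1 n : left_id (@autinf_one n) (@autinf_mul n).
Proof. by move=> f; exact: autinf_eqP. Qed.

Lemma autinf_mulr1 n : right_id (@autinf_one n) (@autinf_mul n).
Proof. by move=> f; exact: autinf_eqP. Qed.

Lemma autinf_mulV n :
  left_inverse (@autinf_one n) (@autinf_inv n) (@autinf_mul n).
Proof. by move=> f; apply: autinf_eqP => x /=; rewrite autinf_funK. Qed.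

Lemma autinf_mulrV n :
  right_inverse (@autinf_one n) (@autinf_inv n) (@autinf_mul n).
Proof. by move=> f; apply: autinf_eqP => x /=; rewrite autinf_invK. Qed.

HB.instance Definition _ n := isGroup.Build (autinf n)
  (@autinf_mulA n) (@autinf_mul1 n) (@autinf_mulr1 n)
  (@autinf_mulV n) (@autinf_mulrV n).

Lemma autinfME n (f g : autinf n) x : (f * g)%g x = f (g x).
Proof. by []. Qed.

Lemma autinf1E n (x : fullshift n) : (1%g : autinf n) x = x.
Proof. by []. Qed.

Lemma autinfVK n (f : autinf n) : cancel f (f^-1)%g.
Proof. exact: autinf_funK. Qed.

(* fingroup's #[x] needs a finite ambient group. *)
Definition has_order (G : groupType) (x : G) (k : nat) : Prop :=
  [/\ (0 < k)%N, (x ^+ k = 1)%g &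
      forall m, (0 < m)%N -> (x ^+ m = 1)%g -> (k <= m)%N].

(* Orbit of x under the cyclic group generated by f: all integer powers. *)
Definition cyclic_orbit n (f : autinf n) (x : fullshift n) :
    set (fullshift n) :=
  [set (f ^+ m)%g x | m in [set: nat]] `|`
  [set (f ^- m)%g x | m in [set: nat]].

(* Main.v *)
Require Import Defs.
From mathcomp Require Import all_boot all_order all_algebra.
From mathcomp Require Import all_fingroup all_solvable.
From mathcomp Require Import monoid.
From mathcomp Require Import boolp classical_sets functions cardinality.
From mathcomp Require Import topology zify.

Set Implicit Arguments.
Unset Strict Implicit.
Unset Printing Implicit Defensive.

Import Order.TTheory GRing.Theory Num.Theory.

(** Write sigma for the shift. Orders are preserved because Psi is injective,
and orbits reduce to elements of prime order: if Psi phi ^+ i has a fixed point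
for some 0 < i < k, then so does Psi q for some power q of phi of prime order p,
and this q acts freely. So it is enough that Psi sends free elements of prime
order to elements without fixed points ([prime_order_free]). Four facts carry
this.

Normal form ([free_normal_form]). A free q with q ^+ p = 1 is conjugate, inside
the group, to a gate: a permutation of the words of some length M, applied to
all the blocks of length M at once. The windows of x, q x, ..., q ^+ (p - 1) x
around sparse positions cut a point into independent segments; q is
transported along the segments to a map that acts blockwise, and the segments
are straightened one by one with powers of q and of that map. Free gates stay
free gates when they are read on longer blocks.

Ghost center ([ghost_center_shift]). Every element commutes with a power of
sigma, so g = Psi sigma has the same property, Psi being onto. A power of g then
commutes with all the gates on blocks of length 3 and with the map that shifts
one coordinate out of three; such a map is a power of sigma. Hence
Psi (sigma ^+ k) is sigma ^+ c for some k > 0 and some nonzero integer c.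

Rigidity of symmetric groups ([free_perm_rigid]). Let D be a finite set with
p ^ 4 dividing #|D|, let pi be a free permutation of D of order p, and let theta
be an action of the whole symmetric group of D on a finite set Y. If theta pi
moves fewer than #|D| points, then theta pi is trivial: pi lies in the normal
closure, within its own centralizer, of a large alternating group that has too
few moved cycles of theta pi to act on.

Periodic points ([embedding_rigid]). If Psi (sigma ^+ k) is sigma ^+ l or
sigma ^- l with l <= k, the gates on blocks of length k e act through Psi on the
periodic points of period l e, of which there are n ^ (l e) <= n ^ (k e). If
l < k, or if the image of a free gate pi has a fixed point (a periodic one then
exists too), rigidity makes Psi pi trivial on these periodic points for all the
multiples e of a fixed integer. These points are dense, so Psi pi = 1, which
contradicts injectivity. Applied to Psi or to its inverse this leaves only the
case l = k without fixed points. *)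

Local Open Scope group_scope.

(** * Rigidity of actions of finite symmetric groups *)

Lemma perm_fix_coprime (Y : finType) (z : {perm Y}) (y : Y) (d p : nat) :
  coprime d p -> (z ^+ d) y = y -> (z ^+ p) y = y -> z y = y.
Proof.
move=> cop zd zp.
have zM e k : (z ^+ e) y = y -> (z ^+ (k * e)) y = y.
  by move=> ze; elim: k => [|k IH]; rewrite ?perm1 // mulSn expgD permM ze.
have [d0|d0] := posnP d.
  by move: cop zp; rewrite d0 /coprime gcd0n => /eqP ->; rewrite expg1.
case: (egcdnP p d0) => km kn E _; rewrite (eqP cop) in E.
by have := zM _ km zd; rewrite E expgD permM expg1 zM.
Qed.

Lemma card_porbit_prime (Y : finType) (z : {perm Y}) (p : nat) (y : Y) :
  prime p -> z ^+ p = 1 -> z y != y -> #|porbit z y| = p.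
Proof.
move=> pp zp /eqP zy; set d := #|_|.
have zd : (z ^+ d) y = y by rewrite permX; exact: iter_porbit.
have d0 : 0 < d by rewrite /d (cardD1 y) porbit_id.
have [dp|pd|//] := ltngtP d p.
  case: zy; apply: (perm_fix_coprime (d := d) (p := p)) => //; last by rewrite zp perm1.
  by rewrite coprime_sym prime_coprime // gtnNdvd.
have := uniq_traject_porbit z y; rewrite -/d => /(uniqP y) /(_ 0%N p).
rewrite !inE size_traject d0 pd => /(_ isT isT).
rewrite !nth_traject //= -permX zp perm1 => /(_ erefl) p0.
by rewrite -p0 in pp.
Qed.

Lemma trivIset_porbits (Y : finType) (z : {perm Y}) (M : {pred Y}) :
  finset.trivIset [set porbit z y | y in M].
Proof.
apply/finset.trivIsetP => _ _ /imsetP[y _ ->] /imsetP[y' _ ->] ne.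
rewrite -setI_eq0; apply/eqP/setP => x; rewrite !inE; apply/negP => /andP[].
rewrite -!eq_porbit_mem => /eqP E1 /eqP E2.
by move: ne; rewrite -E1 -E2 eqxx.
Qed.

(** The set D below is the model of a free permutation of prime order: the
permutation is the rotation [rot] of the first coordinate, and its cycles are
indexed by T. Its centralizer contains both the permutations of the cycles
([track_perm]) and the rotations of each cycle by its own amount
([twist_perm]). *)
Section Rigid.
Variables (p : nat) (T Y : finType).
Hypothesis pp : prime p.
Let D := ('Z_p * T)%type.

Lemma track_inj (s : {perm T}) : injective (fun x : D => (x.1, s x.2)).
Proof. by move=> [i t] [j t'] /= [-> /perm_inj ->]. Qed.
Definition track_perm s : {perm D} := perm (@track_inj s).

Lemma twist_inj (u : T -> 'Z_p) : injective (fun x : D => ((x.1 + u x.2)%R, x.2)).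
Proof.
move=> [i t] [j t'] E; have /= Et := congr1 snd E; rewrite -Et in E *.
by congr (_, _); apply: (GRing.addIr (u t)); exact: (congr1 fst E).
Qed.
Definition twist_perm u : {perm D} := perm (@twist_inj u).

Let rot := twist_perm (fun=> 1%R).

Lemma track_permM s s' : track_perm (s * s') = track_perm s * track_perm s'.
Proof. by apply/permP => x; rewrite permM !permE. Qed.

Lemma track_perm_rot s : track_perm s * rot = rot * track_perm s.
Proof. by apply/permP => x; rewrite !permM !permE. Qed.

Lemma twist_perm_rot u : twist_perm u * rot = rot * twist_perm u.
Proof. by apply/permP => x; rewrite !permM !permE /= GRing.addrAC. Qed.

Variable theta : {perm D} -> {perm Y}.
Hypothesis thetaM : forall a b, theta (a * b) = theta a * theta b.

Let z := theta rot.
Let moved := [set y | z y != y].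

Hypothesis small : #|moved| < p * #|T|.
Hypothesis T5 : 4 < #|T|.

Lemma theta1 : theta 1 = 1.
Proof. by apply: (mulgI (theta 1)); rewrite -thetaM !mulg1. Qed.

Lemma thetaX a k : theta (a ^+ k) = theta a ^+ k.
Proof. by elim: k => [|k IH]; rewrite ?theta1 // !expgS thetaM IH. Qed.

Lemma rot_expn : rot ^+ p = 1.
Proof.
have rE k (x : D) : (rot ^+ k) x = ((x.1 + k%:R)%R, x.2).
  elim: k => [|k IH]; first by rewrite perm1 GRing.addr0; case: x.
  by rewrite expgSr permM IH permE /= -GRing.addrA -[k.+1]addn1 GRing.natrD.
apply/permP => x; rewrite rE perm1 /=.
by rewrite pchar_Zp ?prime_gt1 // GRing.addr0; case: x.
Qed.

Lemma z_expn : z ^+ p = 1.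
Proof. by rewrite -thetaX rot_expn theta1. Qed.

Let K := [set porbit z y | y in moved].

(** The moved points split into cycles of length p, so the bound on their
number leaves fewer cycles than there are elements in T. *)
Lemma card_moved_orbits : #|K| < #|T|.
Proof.
rewrite -(ltn_pmul2l (prime_gt0 pp)); apply: leq_ltn_trans small.
rewrite mulnC -sum_nat_const.
have -> : \sum_(B in K) p = \sum_(B in K) #|B|.
  apply: eq_bigr => _ /imsetP[y yM ->].
  by rewrite (card_porbit_prime pp z_expn) //; move: yM; rewrite inE.
have /eqP -> : finset.trivIset K by exact: trivIset_porbits.
apply/subset_leq_card/fintype.subsetP => x /finset.bigcupP[_ /imsetP[y yM ->]].
case/porbitP => i ->; rewrite inE in yM; rewrite inE.
apply: contra yM => /eqP E; apply/eqP; apply: (@perm_inj _ (z ^+ i)).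
by rewrite -!permM -expgS expgSr permM.
Qed.

Lemma commute_moved g : g * z = z * g -> forall y, (g y \in moved) = (y \in moved).
Proof.
move=> gz y; rewrite !inE -permM gz permM.
by rewrite (inj_eq (@perm_inj _ g)).
Qed.

Lemma commute_porbit g : g * z = z * g -> forall y, g @: porbit z y = porbit z (g y).
Proof.
move=> gz y; have gzX k x : g ((z ^+ k) x) = (z ^+ k) (g x).
  by rewrite -!permM (commuteX k gz).
apply/setP => x; apply/imsetP/porbitP => [[_ /porbitP[i ->] ->]|[i ->]].
  by exists i; rewrite gzX.
by exists ((z ^+ i) y); rewrite ?gzX //; apply/porbitP; exists i.
Qed.

Lemma theta_track_rot s : theta (track_perm s) * z = z * theta (track_perm s).
Proof. by rewrite /z -!thetaM track_perm_rot. Qed.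

Lemma orbit_move_inj (s : {perm T}) :
  injective (fun k => if k \in K then theta (track_perm s) @: k else k).
Proof.
have mv k : k \in K -> theta (track_perm s) @: k \in K.
  case/imsetP => y yM ->; rewrite commute_porbit ?theta_track_rot //.
  by apply: imset_f; rewrite commute_moved ?theta_track_rot.
move=> k k'; case: ifP => kK; case: ifP => k'K //.
- by move/(imset_inj (@perm_inj _ _)).
- by move=> E; move: k'K; rewrite -E mv.
- by move=> E; move: kK; rewrite E mv.
Qed.
Definition orbit_move s := perm (@orbit_move_inj s).

Lemma orbit_moveM : {in 'Alt_T &, {morph orbit_move : s s' / s * s'}}.
Proof.
move=> s s' _ _; apply/permP => k; rewrite permM !permE.
case: ifP => kK; last by rewrite kK.
rewrite ifT; last first.
  case/imsetP: kK => y yM ->; rewrite commute_porbit ?theta_track_rot //.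
  by apply: imset_f; rewrite commute_moved ?theta_track_rot.
rewrite track_permM thetaM -imset_comp.
by apply: eq_imset => y; rewrite permM.
Qed.
Canonical orbit_move_morphism := Morphism orbit_moveM.

(** The alternating group of T permutes the set K of moved cycles of z. This
action is not faithful: #|T|! / 2 permutations cannot embed in the
permutations of at most #|T| - 1 cycles. Simplicity then makes it
trivial. *)
Lemma alt_fixes_orbits s k : s \in 'Alt_T -> k \in K -> theta (track_perm s) @: k = k.
Proof.
move=> sA kK.
have /simpleP[_ /(_ _ (ker_normal orbit_move_morphism))] := simple_Alt5 T5.
case=> [k1|kA]; last first.
  have : s \in 'ker orbit_move by rewrite kA.
  by move/mker/permP/(_ k); rewrite permE kK perm1.
have inj : 'injm orbit_move by rewrite k1.
have := card_injm inj (subxx _); have := @card_Alt T (ltnW (ltnW (ltnW T5))).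
move=> cA cI.
have le : #|orbit_move @* 'Alt_T| <= (#|K|)`!.
  rewrite -card_perm; apply/subset_leq_card/fintype.subsetP => _ /morphimP[t _ _ ->].
  rewrite unfold_in; apply/fintype.subsetP => k'; rewrite inE permE.
  by case: ifP => //; rewrite eqxx.
have: (#|T|)`! <= 2 * (#|T|.-1)`!.
  rewrite -cA leq_mul2l /= -cI; apply: leq_trans le _.
  by apply: leq_fact; rewrite -ltnS prednK ?card_moved_orbits // (ltn_trans _ T5).
case: #|T| T5 => // m m4; rewrite factS /= leq_mul2r leqNgt.
by rewrite -leqNgt => /orP[/eqP E|]; [have := fact_gt0 m; rewrite E | rewrite leqNgt (ltn_trans _ m4)].
Qed.

(** An element that commutes with z and preserves a cycle of z acts on it as a
power of z, and z has order p. *)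
Lemma alt_pow_fixes_moved s y : s \in 'Alt_T -> y \in moved -> theta (track_perm (s ^+ p)) y = y.
Proof.
move=> sA yM; set g := theta (track_perm s).
have -> : theta (track_perm (s ^+ p)) = g ^+ p.
  rewrite -thetaX; congr theta.
  suff X k : track_perm (s ^+ k) = track_perm s ^+ k by rewrite X.
  elim: k => [|k IH]; last by rewrite !expgS track_permM IH.
  by apply/permP => x; rewrite permE !perm1; case: x.
have gz := theta_track_rot s; rewrite -/g in gz.
have : g y \in porbit z y.
  rewrite -(alt_fixes_orbits sA (imset_f (porbit z) yM)) -/g.
  by apply: imset_f; exact: porbit_id.
case/porbitP => e ge.
have gX k : (g ^+ k) y = (z ^+ (e * k)) y.
  elim: k => [|k IH]; first by rewrite muln0.
  by rewrite expgSr permM IH -permM -(commuteX _ gz) permM ge -permM -expgD mulnS.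
by rewrite gX mulnC expgM z_expn expg1n perm1.
Qed.

(** The equation on u says that rot is the commutator of the twist by u and of
the even track permutation r ^+ p. The latter is trivial on moved points, hence
so is the commutator: a moved point would be fixed by z. *)
Lemma twist_rigid (r : {perm T}) (u : T -> 'Z_p) : r \in 'Alt_T ->
  (forall t, u ((r ^+ p) t) = (u t + 1)%R) -> z = 1.
Proof.
move=> rA ur; set s := r ^+ p.
have E : twist_perm u * track_perm s = track_perm s * twist_perm u * rot^-1.
  apply: (mulIg rot); rewrite mulgKV -mulgA track_perm_rot mulgA.
  apply/permP => x; rewrite !permM !permE /= ur.
  by rewrite GRing.addrA GRing.addrAC.
apply/permP => y; rewrite perm1.
have [yM|] := boolP (y \in moved); last by rewrite inE negbK => /eqP.
have tM : theta (twist_perm u) y \in moved.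
  by rewrite commute_moved // /z -!thetaM twist_perm_rot.
have := congr1 (fun g => (theta (g * rot)) y) E.
rewrite mulgKV !thetaM !permM (alt_pow_fixes_moved rA yM) (alt_pow_fixes_moved rA tM) -/z => Ez.
have := tM; rewrite inE => /eqP[]; exact: Ez.
Qed.
End Rigid.

(** A choice of r and u as needed by [twist_rigid]: r is the p-th power of the
addition of 1 on the integers modulo p ^ 3, and u reads the leading digit in base
p, which p ^ 2 steps of the addition increase by one. *)
Section Coordinates.
Variables (p c : nat).
Hypothesis pp : prime p.
Let T := ('Z_(p ^ 3) * 'I_c)%type.

Let p1 : 1 < p. Proof. exact: prime_gt1. Qed.
Let q1 : 1 < p ^ 3. Proof. by rewrite -{1}(exp1n 3) ltn_exp2r. Qed.

Lemma odometer_inj : injective (fun x : T => ((x.1 + 1)%R, x.2)).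
Proof.
move=> [i t] [j t'] E; have /= Et := congr1 snd E; rewrite -Et.
by congr (_, _); apply: (GRing.addIr 1%R); exact: (congr1 fst E).
Qed.
Definition odometer : {perm T} := perm odometer_inj.

Lemma odometerX k x : (odometer ^+ k) x = ((x.1 + k%:R)%R, x.2).
Proof.
elim: k => [|k IH]; first by rewrite perm1 GRing.addr0; case: x.
by rewrite expgSr permM IH permE /= -GRing.addrA -[k.+1]addn1 GRing.natrD.
Qed.

(** For odd p the odometer has odd order, and for p = 2 the permutation is a
square. *)
Lemma odometerXp_even : odometer ^+ p \in 'Alt_T.
Proof.
have oX (s : {perm T}) k : odd_perm (s ^+ k) = odd k && odd_perm s.
  elim: k => [|k IH]; first by rewrite odd_perm1.
  by rewrite expgS odd_permM IH /=; case: (odd k); case: (odd_perm s).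
rewrite Alt_even oX; have [op|] := boolP (odd p) => //=.
suff : odd_perm (odometer ^+ (p ^ 3)) = false by rewrite oX oddX op /= => ->.
suff -> : odometer ^+ (p ^ 3) = 1 by rewrite odd_perm1.
apply/permP => x; rewrite odometerX perm1 pchar_Zp // GRing.addr0.
by case: x.
Qed.

Definition digit (x : T) : 'Z_p := (x.1 %/ p ^ 2)%:R%R.

Lemma digitS x : digit (((odometer ^+ p) ^+ p) x) = (digit x + 1)%R.
Proof.
have p20 : 0 < p ^ 2 by rewrite expn_gt0 prime_gt0.
rewrite -expgM mulnn odometerX /digit [X in nat_of_ord X]/(x.1 + _)%R GRing.natr1.
have E : (Zp_trunc (p ^ 3)).+2 = (p ^ 3)%N by exact: Zp_cast.
have -> : (x.1 + (p ^ 2)%:R)%R = ((x.1 + p ^ 2) %% p ^ 3)%N :> nat.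
  by rewrite /= val_Zp_nat //; move: (nat_of_ord x.1) => a; rewrite E modnDmr.
rewrite -[RHS]Zp_nat_mod //; congr (_%:R)%R.
move: (nat_of_ord x.1) => a.
by rewrite (expnS p 2) -modn_divl divnDr ?dvdnn // divnn p20 addn1.
Qed.

End Coordinates.

Lemma free_perm_card (D : finType) (p : nat) (pi : {perm D}) :
  prime p -> pi ^+ p = 1 -> (forall x, pi x != x) ->
  #|D| = (p * #|[set porbit pi x | x : D]|)%N.
Proof.
move=> pp piX pif; rewrite mulnC -sum_nat_const.
have -> : (\sum_(B in [set porbit pi x | x : D]) p =
  \sum_(B in [set porbit pi x | x : D]) #|B|)%N.
  by apply: eq_bigr => _ /imsetP[y _ ->]; rewrite (card_porbit_prime pp).
have /eqP -> : finset.trivIset [set porbit pi x | x : D] by exact: trivIset_porbits.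
rewrite -cardsT; congr #|pred_of_set _|.
by apply/setP => x; rewrite inE; apply/esym/finset.bigcupP; exists (porbit pi x);
  rewrite ?porbit_id ?imset_f.
Qed.

(** Every free permutation of prime order is conjugate to the model above as
soon as the number of its cycles is a multiple of p ^ 3: only that number
matters. *)
Lemma free_perm_coordinates (D : finType) (p : nat) (pi : {perm D}) :
  prime p -> pi ^+ p = 1 -> (forall x, pi x != x) -> p ^ 4 %| #|D| ->
  exists c, exists f : 'Z_p * ('Z_(p ^ 3) * 'I_c) -> D,
    bijective f /\ forall i t, f ((i + 1)%R, t) = pi (f (i, t)).
Proof.
move=> pp piX pif p4; set O := [set porbit pi x | x : D].
have p1 := prime_gt1 pp; have p0 := prime_gt0 pp.
have q1 : 1 < p ^ 3 by rewrite -{1}(exp1n 3) ltn_exp2r.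
have cO : #|D| = (p * #|O|)%N by exact: free_perm_card.
pose c := (#|O| %/ p ^ 3)%N.
have cT : #|{: 'Z_(p ^ 3) * 'I_c}| = #|O|.
  rewrite card_prod !card_ord Zp_cast // mulnC divnK //.
  by rewrite -(dvdn_pmul2l p0) -expnS -cO.
exists c.
pose orb (t : 'Z_(p ^ 3) * 'I_c) : {set D} := enum_val (cast_ord cT (enum_rank t)).
have orbO t : orb t \in O by exact: enum_valP.
have orb_inj : injective orb.
  by move=> t t' /enum_val_inj /cast_ord_inj /enum_rank_inj.
have repP t : exists x, porbit pi x == orb t.
  by have /imsetP[x _ ->] := orbO t; exists x.
pose rep t := xchoose (repP t).
have repE t : porbit pi (rep t) = orb t by exact/eqP/(xchooseP (repP t)).
pose f (x : 'Z_p * ('Z_(p ^ 3) * 'I_c)) := (pi ^+ (x.1 : nat)) (rep x.2).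
have pi_mod k : pi ^+ (k %% p) = pi ^+ k.
  by rewrite {2}(divn_eq k p) expgD mulnC expgM piX expg1n mul1g.
exists f; split; last first.
  move=> i t; rewrite /f -permM -expgSr /fst /snd -[in RHS]pi_mod.
  congr (fun_of_perm (_ ^+ _) _).
  by rewrite /= modnDmr addn1; move: (nat_of_ord i) => a; rewrite Zp_cast.
apply: inj_card_bij; last by rewrite card_prod [#|'Z_p|]card_ord Zp_cast // cT -cO.
move=> [i t] [j t'] E.
have Et : t = t'.
  apply: orb_inj; rewrite -!repE; apply/eqP; rewrite eq_porbit_mem.
  rewrite -(porbit_perm pi j) -[(pi ^+ j) _]E.
  by rewrite porbit_perm porbit_id.
rewrite -Et in E *; congr (_, _); apply: val_inj => /=.
have lt_p (k : 'Z_p) : k < p by rewrite -{2}(Zp_cast p1).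
have sep (k l : 'Z_p) : k < l -> (pi ^+ k) (rep t) <> (pi ^+ l) (rep t).
  move=> kl F; have /eqP[] := pif ((pi ^+ k) (rep t)).
  apply: (perm_fix_coprime (d := l - k) (p := p)); last by rewrite piX perm1.
    rewrite coprime_sym prime_coprime // gtnNdvd ?subn_gt0 //.
    by rewrite (leq_ltn_trans (leq_subr _ _)).
  by rewrite -permM -expgD subnKC ?(ltnW kl).
by have [/sep/(_ E)//|/sep/(_ (esym E))//|] := ltngtP i j.
Qed.

(** The fourth power of p provides, after one factor p for the cycles
themselves, the p ^ 3 that the odometer needs. Having fewer than #|D| moved points
covers both a small set Y and a set Y of the size of D with a fixed point of
theta pi. *)
Theorem free_perm_rigid (p : nat) (D Y : finType) (pi : {perm D})
  (theta : {perm D} -> {perm Y}) :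
  prime p -> pi ^+ p = 1 -> (forall x, pi x != x) -> p ^ 4 %| #|D| ->
  (forall a b, theta (a * b) = theta a * theta b) ->
  #|[set y | theta pi y != y]| < #|D| -> theta pi = 1.
Proof.
move=> pp piX pif p4 thM small.
have [c [f [[g fK gK] fS]]] := free_perm_coordinates pp piX pif p4.
have p1 := prime_gt1 pp.
have q1 : 1 < p ^ 3 by rewrite -{1}(exp1n 3) ltn_exp2r.
have tr_inj (s : {perm 'Z_p * ('Z_(p ^ 3) * 'I_c)}) : injective (f \o s \o g).
  by apply: inj_comp (can_inj gK); apply: inj_comp (can_inj fK) perm_inj.
pose tr s : {perm D} := perm (tr_inj s).
have trM s s' : tr (s * s') = tr s * tr s'.
  by apply/permP => x; rewrite permM !permE /= fK permM.
pose th s := theta (tr s).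
have thM' s s' : th (s * s') = th s * th s' by rewrite /th trM thM.
have rotE : tr (twist_perm (fun=> 1%R)) = pi.
  apply/permP => x; rewrite permE /= permE /= fS -[in RHS](gK x).
  by case: (g x).
have cD : #|D| = (p * #|{: 'Z_(p ^ 3) * 'I_c}|)%N.
  have := bij_eq_card (Bijective fK gK).
  by rewrite card_prod [X in (X * _)%N]card_ord Zp_cast.
rewrite -rotE -/(th _); apply: (twist_rigid pp thM' _ _ (odometerXp_even c pp) (digitS pp)).
- by rewrite /th rotE -cD.
- have c0 : 0 < c.
    rewrite lt0n; apply/eqP => c0; move: small; rewrite cD card_prod !card_ord c0.
    by rewrite !muln0.
  rewrite card_prod !card_ord Zp_cast //; apply: leq_trans (leq_pmulr _ c0).
  by apply: (@leq_trans (2 ^ 3)%N) => //; rewrite leq_exp2r.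
Qed.

Local Close Scope group_scope.
Local Open Scope ring_scope.
Local Open Scope classical_set_scope.

(** * Sliding block codes *)

Section Topology.
Variable n : nat.
Local Notation X := (fullshift n).

(** The r-neighbourhood of a coordinate determines the image at that
coordinate: a sliding block code whose rule may depend on the coordinate. *)
Definition local_rule (r : nat) (f : X -> X) := forall (x y : X) (i : int),
  (forall j : int, `|j - i| <= r%:Z -> x j = y j) -> f x i = f y i.

Lemma near_coord (x : X) (i : int) : \forall y \near x, (y : X) i = x i.
Proof.
have cx := @proj_continuous int (fun=> discrete_topology 'I_n) i x.
exact: (cx [set x i] (discrete_set1 _)).
Qed.

Lemma fullshift_cvg (F : set_system X) (x : X) : Filter F ->
  (forall t : int, F [set y : X | y t = x t]) -> F --> x.
Proof.
move=> FF Fx.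
have [_ H] := @pointwise_cvgP (discrete_topology int) (discrete_topology 'I_n) F x FF.
by apply: H => t; apply/discrete_cvg; exact: Fx.
Qed.

(** Points that avoid U while agreeing with x on larger and larger windows would
converge to x. *)
Lemma nbhs_cylinder (x : X) (U : set X) : nbhs x U ->
  exists r : nat, forall y : X, (forall j : int, `|j| <= r%:Z -> y j = x j) -> U y.
Proof.
move=> xU; apply: contrapT => /forallNP H.
have {}H r : exists y : X, (forall j : int, `|j| <= r%:Z -> y j = x j) /\ ~ U y.
  by have /existsNP[y /not_implyP[yx nU]] := H r; exists y.
have [u uP] := choice H.
have : u @ \oo --> x.
  apply: fullshift_cvg => t /=.
  near=> m; have [+ _] := uP m; apply.
  have : (absz t <= m)%N by near: m; exact: nbhs_infty_ge.
  by lia.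
move=> /(_ _ xU) [m _ /(_ m (leqnn m)) Um].
by have [] := uP m.
Unshelve. all: by end_near. Qed.

Lemma near_cylinder (x : X) (r : nat) :
  \forall y \near x, forall i : int, `|i| <= r%:Z -> (y : X) i = x i.
Proof.
elim: r => [|r IH].
  near=> y => i i0. have -> : i = 0 by lia. near: y. exact: near_coord.
near=> y => i ir.
have [E|E] := boolP (`|i| <= r%:Z).
  by move: i E {ir}; near: y.
have [->|->] : i = r.+1%:Z \/ i = - r.+1%:Z by lia.
  by near: y; exact: near_coord.
by near: y; exact: near_coord.
Unshelve. all: by end_near. Qed.

(** Compactness of the full shift, in the form in which it is used: every
sequence comes back close to some point. *)
Lemma fullshift_cluster (u : nat -> X) : exists x : X, forall (r N : nat),
  exists2 m, (N <= m)%N & forall i : int, `|i| <= r%:Z -> u m i = x i.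
Proof.
have cA : compact [set: discrete_topology 'I_n].
  exact/finite_compact/finite_finset.
have [|x [_ cx]] := @tychonoff int (fun=> discrete_topology 'I_n) (fun=> setT)
  (fun=> cA) (u @ \oo) _ _.
  by near=> m.
exists x => r N.
have [||y [[m Nm <-] yx]] := cx (u @` [set m | (N <= m)%N])
    [set y : X | forall i : int, `|i| <= r%:Z -> y i = x i].
- by exists N => // m Nm /=; exists m.
- exact: near_cylinder.
by exists m.
Unshelve. all: by end_near. Qed.

(** Half of the Curtis-Hedlund-Lyndon theorem. If windows of every size failed,
a cluster point of the failing pairs would contradict continuity. *)
Lemma continuous_coord_window (f : X -> X) (i : int) : continuous f ->
  exists r : nat, forall x y : X,
    (forall j : int, `|j| <= r%:Z -> x j = y j) -> f x i = f y i.
Proof.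
move=> cf; apply: contrapT => /forallNP H.
have {}H r : exists xy : X * X, (forall j : int, `|j| <= r%:Z -> xy.1 j = xy.2 j)
   /\ f xy.1 i <> f xy.2 i.
  have /existsNP[x /existsNP[y /not_implyP[xy fxy]]] := H r.
  by exists (x, y).
have [g gP] := choice H.
have [x xP] := fullshift_cluster (fst \o g).
have /nbhs_cylinder[r rP] : \forall y \near x, f y i = f x i.
  exact: cf (near_coord (f x) i).
have [m rm xm] := xP r r.
have [agr []] := gP m.
rewrite (rP _ xm) rP // => j jr; rewrite -agr; last by lia.
exact: xm.
Qed.

Lemma local_rule_continuous r (f : X -> X) : local_rule r f -> continuous f.
Proof.
move=> lf x; have FF : Filter (f @ x) by apply: fmap_filter; exact: nbhs_filter.
apply: fullshift_cvg => t /=.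
near=> y; apply: lf => j jt.
have : `|j| <= (r + absz t)%:Z by lia.
by move: j {jt}; near: y; exact: near_cylinder.
Unshelve. all: by end_near. Qed.
End Topology.

(** * Shifts as elements of the stabilized automorphism group *)

Section Shifts.
Variable n : nat.
Local Notation X := (fullshift n).

Definition shiftz (c : int) (x : X) : X := fun i => x (i + c).

Lemma shiftzD c d x : shiftz c (shiftz d x) = shiftz (c + d) x.
Proof. by apply/funext => i; rewrite /shiftz addrA. Qed.

Lemma shiftz0 x : shiftz 0 x = x.
Proof. by apply/funext => i; rewrite /shiftz addr0. Qed.

Lemma iter_shift k : iter k (@shift n) = shiftz k.
Proof.
apply/funext => x; elim: k => [|k IH]; first by rewrite shiftz0.
by rewrite iterS IH -[shift _]/(shiftz 1 _) shiftzD.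
Qed.

Lemma local_rule_shiftz c : local_rule `|c| (shiftz c).
Proof. by move=> x y i; apply; lia. Qed.

Lemma local_is_autinf r r' (f g : X -> X) (k : nat) :
  local_rule r f -> local_rule r' g -> cancel f g -> cancel g f ->
  (0 < k)%N -> (forall x, f (shiftz k x) = shiftz k (f x)) -> is_autinf f.
Proof.
move=> lf lg fK gK k0 fk; split.
  split; first exact: local_rule_continuous lf.
  by exists g; split => //; exact: local_rule_continuous lg.
by exists k => //; rewrite iter_shift; apply/funext => x /=.
Qed.

Lemma shiftz_is_autinf c : is_autinf (shiftz c).
Proof.
apply: (@local_is_autinf `|c| `|- c| _ (shiftz (- c)) 1) => //.
- exact: local_rule_shiftz.
- exact: local_rule_shiftz.
- by move=> x; rewrite shiftzD addNr shiftz0.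
- by move=> x; rewrite shiftzD subrr shiftz0.
- by move=> x; rewrite !shiftzD addrC.
Qed.

Definition Shift c : autinf n := Autinf (asboolT (shiftz_is_autinf c)).

Lemma ShiftE c x : Shift c x = shiftz c x. Proof. by []. Qed.

Lemma ShiftD c d : Shift (c + d) = (Shift c * Shift d)%g.
Proof. by apply: autinf_eqP => x; rewrite autinfME !ShiftE shiftzD. Qed.

Lemma ShiftX c k : (Shift c ^+ k)%g = Shift (c * k%:Z).
Proof.
elim: k => [|k IH].
  by rewrite mulr0; apply: autinf_eqP => x; rewrite ShiftE shiftz0.
by rewrite monoid.expgS IH -ShiftD; congr Shift; lia.
Qed.

(** Negative multiples come for free because shifts are invertible. *)
Lemma shift_comm_mulz (f : X -> X) (k : nat) (q : int) :
  (forall x, f (shiftz k x) = shiftz k (f x)) ->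
  forall x, f (shiftz (q * k%:Z) x) = shiftz (q * k%:Z) (f x).
Proof.
move=> fk; have pos (m : nat) x : f (shiftz (m%:Z * k%:Z) x) = shiftz (m%:Z * k%:Z) (f x).
  elim: m x => [|m IH] x; first by rewrite mul0r !shiftz0.
  have -> : m.+1%:Z * k%:Z = k%:Z + m%:Z * k%:Z by lia.
  by rewrite -!shiftzD fk IH.
move=> x; have [m [->|->]] : exists m : nat, q = m%:Z \/ q = - m%:Z.
  by exists `|q|%N; lia.
- exact: pos.
have := pos m (shiftz (- m%:Z * k%:Z) x).
rewrite shiftzD mulNr subrr shiftz0 => ->.
by rewrite shiftzD addNr shiftz0.
Qed.

Lemma autinf_period (f : autinf n) : exists2 k, (0 < k)%N &
  forall x, f (shiftz k x) = shiftz k (f x).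
Proof.
have [_ [k k0 fk]] := autinfP f; exists k => // x.
by rewrite -iter_shift; exact: (congr1 (@^~ x) fk).
Qed.

(** The other half: commutation with a power of the shift reduces the coordinates
to finitely many residues, over which the windows are bounded. *)
Lemma autinf_local (f : autinf n) : exists r, local_rule r f.
Proof.
have [[cf _] _] := autinfP f; have [k k0 fk] := autinf_period f.
have [r rP] := choice (fun i : nat => continuous_coord_window i%:Z cf).
exists (\max_(i < k) r i + k)%N => x y i xy.
have k0' : k%:Z != 0 by lia.
set q := (i %/ k)%Z; set a := `|(i %% k)%Z|%N.
have ak : (a < k)%N by rewrite -ltz_nat gez0_abs ?modz_ge0 // ltz_pmod.
have iE : i = a%:Z + q * k%:Z.
  by rewrite gez0_abs ?modz_ge0 // addrC -divz_eq.
have shE z : f z i = f (shiftz (q * k%:Z) z) a%:Z.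
  by rewrite (shift_comm_mulz q fk) /shiftz -iE.
rewrite !shE; apply: (rP a) => j jr; apply: xy.
have := @leq_bigmax _ (fun i : 'I_k => r i) (Ordinal ak); rewrite /= => rm.
by rewrite iE; lia.
Qed.
End Shifts.

(** * Gates and periodic points *)

Section Blocks.
Variable n : nat.
Local Notation X := (fullshift n).
Variable m : nat.
Local Notation W := {ffun 'I_m.+1 -> 'I_n}.

Definition win (c : int) (x : X) : W := [ffun i : 'I_m.+1 => x (c + i%:Z)].
Definition residue (i : int) : 'I_m.+1 := inord `|(i %% m.+1)%Z|.
Definition block_start (i : int) : int := (i %/ m.+1)%Z * m.+1.
Definition periodic (w : W) : X := fun i => w (residue i).
Definition gate_fun (s : W -> W) (x : X) : X :=
  fun i => s (win (block_start i) x) (residue i).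

Lemma residueE (i : int) : (residue i : nat)%:Z = (i %% m.+1)%Z.
Proof.
have lt : (`|(i %% m.+1)%Z| < m.+1)%N.
  by rewrite -ltz_nat gez0_abs ?modz_ge0 // ltz_pmod.
by rewrite /residue inordK // gez0_abs ?modz_ge0.
Qed.

Lemma block_decomp (i : int) : i = block_start i + (residue i : nat)%:Z.
Proof. by rewrite residueE; exact: divz_eq. Qed.

Lemma residue_block (q : int) (k : 'I_m.+1) : residue (q * m.+1%:Z + k%:Z) = k.
Proof.
apply: val_inj; apply/eqP; rewrite -eqz_nat residueE modzMDl modz_small //.
by have := ltn_ord k; lia.
Qed.

Lemma block_start_block (q : int) (k : 'I_m.+1) :
  block_start (q * m.+1%:Z + k%:Z) = q * m.+1%:Z.
Proof.
rewrite /block_start divzMDl // divz_small ?addr0 //.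
by have := ltn_ord k; lia.
Qed.

Lemma win_eq c x y : win c x = win c y <->
  forall j : int, c <= j < c + m.+1%:Z -> x j = y j.
Proof.
split=> [E j /andP[cj jc]|E]; last first.
  by apply/ffunP => i; rewrite !ffunE; apply: E; have := ltn_ord i; lia.
have lt : (`|j - c| < m.+1)%N by lia.
have /ffunP/(_ (Ordinal lt)) := E; rewrite !ffunE /=.
by have -> : c + `|j - c|%N%:Z = j by lia.
Qed.

Lemma win_shift c d x : win c (shiftz d x) = win (c + d) x.
Proof. by apply/ffunP => i; rewrite !ffunE /shiftz; congr x; lia. Qed.

Lemma win_gate s q x : win (q * m.+1%:Z) (gate_fun s x) = s (win (q * m.+1%:Z) x).
Proof.
by apply/ffunP => i; rewrite ffunE /gate_fun residue_block block_start_block.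
Qed.

Lemma win_periodic q w : win (q * m.+1%:Z) (periodic w) = w.
Proof. by apply/ffunP => i; rewrite ffunE /periodic residue_block. Qed.

Lemma block_ext x y : (forall q, win (q * m.+1%:Z) x = win (q * m.+1%:Z) y) -> x = y.
Proof.
move=> E; apply/funext => i; rewrite (block_decomp i).
by have /ffunP/(_ (residue i)) := E (i %/ m.+1)%Z; rewrite !ffunE.
Qed.

Lemma gate_comp s t x : gate_fun s (gate_fun t x) = gate_fun (s \o t) x.
Proof. by apply: block_ext => q; rewrite !win_gate. Qed.

Lemma gate_id x : gate_fun id x = x.
Proof. by apply: block_ext => q; rewrite !win_gate. Qed.

Lemma gate_shift s x : gate_fun s (shiftz m.+1 x) = shiftz m.+1 (gate_fun s x).
Proof.
apply: block_ext => q; rewrite win_gate !win_shift.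
have -> : q * m.+1%:Z + m.+1%:Z = (q + 1) * m.+1%:Z by lia.
by rewrite win_gate.
Qed.

Lemma gate_local s : local_rule m.+1 (gate_fun s).
Proof.
move=> x y i xy; rewrite /gate_fun; congr (s _ _).
apply/win_eq => j jr; apply: xy; have := block_decomp i.
by have := ltn_ord (residue i); lia.
Qed.

Lemma gate_is_autinf (s : {perm W}) : is_autinf (gate_fun s).
Proof.
apply: (@local_is_autinf _ m.+1 m.+1 _ (gate_fun (s^-1)%g) m.+1) => //.
- exact: gate_local.
- exact: gate_local.
- by move=> x; rewrite gate_comp -[RHS]gate_id; congr (gate_fun _ x);
    apply/funext => w; rewrite /= permK.
- by move=> x; rewrite gate_comp -[RHS]gate_id; congr (gate_fun _ x);
    apply/funext => w; rewrite /= permKV.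
- exact: gate_shift.
Qed.

Definition gate (s : {perm W}) : autinf n := Autinf (asboolT (gate_is_autinf s)).

Lemma gateE s x : gate s x = gate_fun s x. Proof. by []. Qed.

(** The order is reversed since permutations compose from left to right and maps
from right to left. *)
Lemma gateM s t : gate (s * t)%g = (gate t * gate s)%g.
Proof.
apply: autinf_eqP => x; rewrite autinfME !gateE gate_comp.
by congr (gate_fun _ x); apply/funext => w; rewrite /= permM.
Qed.

Lemma gate1 : gate 1%g = 1%g.
Proof.
apply: autinf_eqP => x; rewrite gateE -[RHS]gate_id.
by congr (gate_fun _ x); apply/funext => w; rewrite /= perm1.
Qed.

Lemma gate_Shift_commute s : (gate s * Shift n m.+1)%g = (Shift n m.+1 * gate s)%g.
Proof. by apply: autinf_eqP => x; exact: gate_shift. Qed.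

Lemma periodic_shift w : shiftz m.+1 (periodic w) = periodic w.
Proof.
apply: block_ext => q; rewrite win_shift.
have -> : q * m.+1%:Z + m.+1%:Z = (q + 1) * m.+1%:Z by lia.
by rewrite !win_periodic.
Qed.

Lemma periodic_win x : shiftz m.+1 x = x -> periodic (win 0 x) = x.
Proof.
move=> xp; apply: block_ext => q; rewrite win_periodic.
have xq : shiftz (q * m.+1%:Z) x = x.
  by symmetry; exact: (@shift_comm_mulz n (fun=> x) m.+1 q (fun=> esym xp) x).
by rewrite -[in LHS]xq win_shift add0r.
Qed.

Lemma periodic_inj : injective periodic.
Proof. by move=> w w' E; rewrite -(win_periodic 0 w) E win_periodic. Qed.
End Blocks.

(** * Maps commuting with three-track gates are shifts *)

Section Tracks.
Variable n : nat.
Local Notation X := (fullshift n).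
Local Notation A := 'I_n.
Local Notation W := {ffun 'I_3 -> A}.

(** The full shift is read as three interleaved tracks, the residue classes of
coordinates modulo 3. *)
Definition track_shift (k : 'I_3) (N : nat) (x : X) : X :=
  fun i => if residue 2 i == k then x (i + (N * 3)%N%:Z) else x i.

Lemma residue_shift (i : int) (N : int) : residue 2 (i + N * 3) = residue 2 i.
Proof. by rewrite /residue addrC modzMDl. Qed.

Lemma track_shiftE k N x i : track_shift k N x i =
  if residue 2 i == k then x (i + (N * 3)%N%:Z) else x i.
Proof. by []. Qed.

Lemma track_shift_is_autinf k : is_autinf (track_shift k 1).
Proof.
pose g (x : X) : X := fun i => if residue 2 i == k then x (i - 3) else x i.
have r3 i : residue 2 (i + 3) = residue 2 i := residue_shift i 1.
have r3' i : residue 2 (i - 3) = residue 2 i := residue_shift i (-1).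
apply: (@local_is_autinf _ 3 3 _ g 3) => //.
- by move=> x y i xy; rewrite /track_shift; case: ifP => _; apply: xy; lia.
- by move=> x y i xy; rewrite /g; case: ifP => _; apply: xy; lia.
- move=> x; apply/funext => i; rewrite /g /track_shift r3'.
  by case: ifP => ik; rewrite ?ik //; congr x; lia.
- move=> x; apply/funext => i; rewrite /g /track_shift r3.
  by case: ifP => ik; rewrite ?ik //; congr x; lia.
- move=> x; apply/funext => i; rewrite /shiftz /track_shift r3.
  by case: ifP => ik; rewrite ?ik //; congr x; lia.
Qed.

Definition Track_shift k : autinf n := Autinf (asboolT (track_shift_is_autinf k)).

Lemma track_shiftS k N x : track_shift k N.+1 x = track_shift k 1 (track_shift k N x).
Proof.
apply/funext => i; rewrite /track_shift (residue_shift i 1).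
by case: ifP => // _; congr x; lia.
Qed.

Lemma swap_inj (k l : 'I_3) : injective (fun w : W => [ffun i => w (tperm k l i)]).
Proof.
move=> w w' E; apply/ffunP => i.
by have /ffunP/(_ (tperm k l i)) := E; rewrite !ffunE tpermK.
Qed.
Definition swap (k l : 'I_3) : {perm W} := perm (@swap_inj k l).

Lemma swapE k l (x : X) (q : int) (j : 'I_3) :
  gate (swap k l) x (q * 3 + j%:Z) = x (q * 3 + (tperm k l j)%:Z).
Proof.
by rewrite gateE /gate_fun residue_block block_start_block permE !ffunE.
Qed.

Variables (a0 a1 : A).
Let o0 : 'I_3 := ord0.
Let o1 : 'I_3 := inord 1.
Let o2 : 'I_3 := inord 2.
Let o02 : (o0 == o2) = false. Proof. by apply/eqP => /(congr1 val); rewrite /= inordK. Qed.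
Let o12 : (o1 == o2) = false. Proof. by apply/eqP => /(congr1 val); rewrite /= !inordK. Qed.

Let o01 : (o0 == o1) = false. Proof. by apply/eqP => /(congr1 val); rewrite /= inordK. Qed.

Lemma ord3P (k : 'I_3) : k = o0 \/ k = o1 \/ k = o2.
Proof.
case: k => [[|[|[|k]]] lt] //; [left|right; left|right; right];
  by apply: val_inj; rewrite /= ?inordK.
Qed.

(** A controlled transposition of the letters a0 and a1 on the third track; the
controls are the letter a on the first track and a1 on the second one. On bits
this is the Toffoli gate. Its role is to make the map below compatible with
intersections of sets of coordinates. *)
Lemma toffoli_inj (a : A) : injective (fun w : W =>
  [ffun i => if [&& i == o2, w o0 == a & w o1 == a1] then tperm a0 a1 (w i) else w i]).
Proof.
move=> w w' E; apply/ffunP => i.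
have E0 : w o0 = w' o0 by have /ffunP/(_ o0) := E; rewrite !ffunE o02.
have E1 : w o1 = w' o1 by have /ffunP/(_ o1) := E; rewrite !ffunE o12.
have /ffunP/(_ i) := E; rewrite !ffunE E0 E1.
by case: ifP => // _ /perm_inj.
Qed.
Definition toffoli a : {perm W} := perm (@toffoli_inj a).

Variable f : autinf n.
Hypothesis f_gate : forall (s : {perm W}) x, f (gate s x) = gate s (f x).
Hypothesis f_track0 : forall x, f (track_shift ord0 1 x) = track_shift ord0 1 (f x).

Lemma f_track_shift k N x : f (track_shift k N x) = track_shift k N (f x).
Proof.
have step y : f (track_shift k 1 y) = track_shift k 1 (f y).
  have conj z : track_shift k 1 z =
      gate (swap ord0 k) (track_shift ord0 1 (gate (swap ord0 k) z)).
    apply: (@block_ext _ 2) => q; apply/ffunP => j; rewrite !ffunE swapE /track_shift.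
    rewrite !residue_block -(inj_eq (@perm_inj _ (tperm ord0 k))) tpermR.
    case: ifP => _.
      have -> : q * 3 + (tperm ord0 k j)%:Z + (1 * 3)%N%:Z =
        (q + 1) * 3 + (tperm ord0 k j)%:Z by lia.
      by rewrite swapE tpermK; congr z; lia.
    by rewrite swapE tpermK.
  by rewrite !conj !f_gate f_track0 f_gate.
elim: N x => [|N IH] x.
  have t0 y : track_shift k 0 y = y.
    by apply/funext => i; rewrite /track_shift addr0 if_same.
  by rewrite !t0.
by rewrite track_shiftS step IH -track_shiftS.
Qed.

Lemma f_shift3 x : f (shiftz 3 x) = shiftz 3 (f x).
Proof.
have E y : shiftz 3 y = track_shift o0 1 (track_shift o1 1 (track_shift o2 1 y)).
  apply/funext => i; rewrite /shiftz /track_shift !(residue_shift i 1).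
  have [->|[->|->]] := ord3P (residue 2 i); rewrite !eqxx ?o01 ?o02 ?o12.
  - by [].
  - by rewrite eq_sym o01.
  - by rewrite eq_sym o02 eq_sym o12.
by rewrite !E !f_track_shift.
Qed.

(** Replace x by y on the track k, but only far away from i: locality hides the
replacement at i. A power of the shift of the track k brings the replaced part
back around i and does not touch the value at i. *)
Lemma f_other_track (k : 'I_3) (x y : X) (i : int) : residue 2 i != k ->
  (forall j, residue 2 j != k -> x j = y j) -> f x i = f y i.
Proof.
move=> ik xy; have [r fr] := autinf_local f.
pose N := r.+1.
pose z : X := fun j => if (residue 2 j == k) && (i + r%:Z < j)
  then y (j - (N * 3)%N%:Z) else x j.
have -> : f x i = f z i.
  by apply: fr => j jr; rewrite /z (_ : i + r%:Z < j = false) ?andbF //; lia.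
have -> : f z i = track_shift k N (f z) i by rewrite track_shiftE (negPf ik).
rewrite -f_track_shift; apply: fr => j jr; rewrite track_shiftE /z.
have [jk|jk] := boolP (residue 2 j == k); last exact: xy.
have -> : residue 2 (j + (N * 3)%N%:Z) = residue 2 j.
  by rewrite PoszM residue_shift.
by rewrite jk /= ifT; [congr y; lia | rewrite /N; lia].
Qed.

Definition track (k : 'I_3) (x : X) : int -> A := fun q => x (q * 3 + k%:Z).
Definition weave (u : 'I_3 -> int -> A) : X := fun i => u (residue 2 i) (i %/ 3)%Z.
Definition diag (u : int -> A) : X := weave (fun=> u).
Definition track_map (u : int -> A) : int -> A := track ord0 (f (diag u)).

Lemma weaveE u q (k : 'I_3) : weave u (q * 3 + k%:Z) = u k q.
Proof.
rewrite /weave residue_block; congr u.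
have := block_start_block q k; rewrite /block_start; lia.
Qed.

Lemma diagE u q (k : 'I_3) : diag u (q * 3 + k%:Z) = u q.
Proof. exact: (weaveE (fun=> u)). Qed.

(** The two remaining tracks are replaced one after the other. *)
Lemma f_same_track k x y : (forall q, track k x q = track k y q) ->
  forall q, track k (f x) q = track k (f y) q.
Proof.
move=> xy q.
pose mix (l : 'I_3) (u v : X) : X := fun i => if residue 2 i == l then u i else v i.
have [l [l' [kl kl' ll']]] : exists l l' : 'I_3, [/\ k != l, k != l' &
  forall j, j != l -> j != l' -> j = k].
  by have [->|[->|->]] := ord3P k;
    [exists o1, o2 | exists o0, o2 | exists o0, o1]; split;
    rewrite ?[_ == o0]eq_sym ?[o2 == _]eq_sym ?o01 ?o02 ?o12 // => j;
    have [->|[->|->]] := ord3P j; rewrite ?eqxx.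
have rk : residue 2 (q * 3 + k%:Z) = k by rewrite residue_block.
rewrite /track (@f_other_track l x (mix l y x)) ?rk //; last first.
  by move=> j; rewrite /mix => /negPf ->.
apply: (@f_other_track l'); rewrite ?rk // => j jl'; rewrite /mix.
case: ifP => // /negbT jl; have jk := ll' _ jl jl'.
by rewrite (block_decomp 2 j) jk; exact: xy.
Qed.

(** Each track of the image depends on one track only, and swapping tracks shows
that the dependence is the same on the three of them: f is track_map three
times. *)
Lemma f_trackwise x k q : track k (f x) q = track_map (track k x) q.
Proof.
rewrite (@f_same_track k x (diag (track k x))); last first.
  by move=> q'; rewrite /track diagE.
have swd u : gate (swap ord0 k) (diag u) = diag u.
  apply: (@block_ext _ 2) => q'; apply/ffunP => j.
  by rewrite !ffunE swapE !diagE.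
by rewrite /track_map /track -{2}swd f_gate swapE tpermL.
Qed.

Lemma track_map_shift u (c : int) q : track_map (fun i => u (i + c)) q = track_map u (q + c).
Proof.
have -> : track_map (fun i => u (i + c)) = track ord0 (f (shiftz (c * 3%:Z) (diag u))).
  rewrite /track_map; congr (track _ (f _)).
  apply: (@block_ext _ 2) => q'; apply/ffunP => j; rewrite !ffunE diagE /shiftz.
  have -> : q' * 3 + j%:Z + c * 3%:Z = (q' + c) * 3 + j%:Z by lia.
  by rewrite diagE.
rewrite (shift_comm_mulz c f_shift3) /track /shiftz.
by congr (f _ _); lia.
Qed.

Lemma track_map_inj u v : track_map u = track_map v -> u = v.
Proof.
move=> uv; have E : f (diag u) = f (diag v).
  apply: (@block_ext _ 2) => q; apply/ffunP => j; rewrite !ffunE.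
  have := f_trackwise (diag u) j q; have := f_trackwise (diag v) j q; rewrite /track => -> ->.
  have dE w : (fun q => diag w (q * 3 + j%:Z)) = w by apply/funext => q'; rewrite diagE.
  by rewrite /track !dE uv.
have [[_ [g [_ fK _]]] _] := autinfP f.
have {}E := can_inj fK E; apply/funext => q.
by rewrite -(diagE u q o0) E diagE.
Qed.

Lemma track_map_surj v : exists u, track_map u = v.
Proof.
have [[_ [g [_ _ gK]]] _] := autinfP f.
exists (track ord0 (g (diag v))); apply/funext => q.
by rewrite -f_trackwise gK /track diagE.
Qed.

Hypothesis a0a1 : a0 <> a1.
Let tau : A -> A := tperm a0 a1.

Lemma track_map_toffoli a u v w :
  track_map (fun q => if (u q == a) && (v q == a1) then tau (w q) else w q) =
  fun q => if (track_map u q == a) && (track_map v q == a1) then tau (track_map w q)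
           else track_map w q.
Proof.
pose t (k : 'I_3) := if k == o0 then u else if k == o1 then v else w.
have gE y q : gate (toffoli a) y (q * 3 + (o2 : nat)%:Z) =
   if (track o0 y q == a) && (track o1 y q == a1) then tau (track o2 y q) else track o2 y q.
  rewrite gateE /gate_fun residue_block block_start_block permE !ffunE eqxx /=.
  by [].
have t0 : track o0 (weave t) = u by apply/funext => q; rewrite /track weaveE /t eqxx.
have t1 : track o1 (weave t) = v.
  by apply/funext => q; rewrite /track weaveE /t eq_sym o01 eqxx.
have t2 : track o2 (weave t) = w.
  by apply/funext => q; rewrite /track weaveE /t ![o2 == _]eq_sym o02 o12.
apply/funext => q; have := congr1 (fun y => track o2 y q) (f_gate (toffoli a) (weave t)).
rewrite f_trackwise [in RHS]/track gE !f_trackwise t0 t1 t2 => <-; congr (track_map _ q).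
by apply/funext => q'; rewrite [RHS]/track gE t0 t1 t2.
Qed.

Let ind (S : int -> bool) : int -> A := fun q => if S q then a1 else a0.
Let flip (S : int -> bool) (w : int -> A) : int -> A :=
  fun q => if S q then tau (w q) else w q.
Let Theta (S : int -> bool) : int -> bool := fun q => track_map (ind S) q == a1.

Let indE S q : (ind S q == a1) = S q.
Proof. by rewrite /ind; case: (S q); rewrite ?eqxx //; apply/eqP. Qed.

Let flip_inj S S' : flip S (fun=> a0) =1 flip S' (fun=> a0) -> S =1 S'.
Proof.
move=> E q; have := E q; rewrite /flip /tau tpermL.
by case: (S q); case: (S' q) => // F; case: a0a1.
Qed.

(** Sets of coordinates are coded by points with letters in a0, a1, and [flip S]
transposes a0 and a1 on S. Then F = track_map carries [flip] of an intersection
to [flip] of the intersection of the images under Theta. *)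
Lemma track_map_flipI S S' w :
  track_map (flip (fun q => S q && S' q) w) = flip (fun q => Theta S q && Theta S' q) (track_map w).
Proof.
rewrite /flip /Theta -track_map_toffoli; congr track_map.
by apply/funext => q; rewrite !indE.
Qed.

(** Theta preserves intersections, the empty set and translations. The image of
a singleton is thus disjoint from its own nontrivial translates, so that it has
at most one element; it is not empty by injectivity. Its only element gives the
amount c of the shift, and the control letter of the gate reads off the value
of an arbitrary point at one coordinate. *)
Lemma track_map_is_shift : exists c, forall u q, track_map u (q + c) = u q.
Proof.
have [w0 w0E] := track_map_surj (fun=> a0).
pose pt (i : int) : int -> bool := fun q => q == i.
have dis i q : i != 0 -> ~~ (Theta (pt 0) q && Theta (pt i) q).
  move=> i0; have := track_map_flipI (pt 0) (pt i) w0.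
  have -> : flip (fun q => pt 0 q && pt i q) w0 = w0.
    apply/funext => q'; rewrite /flip /pt; case: ifP => // /andP[/eqP -> /eqP E].
    by rewrite E eqxx in i0.
  rewrite w0E => E; have := @flip_inj (fun=> false) (fun q => Theta (pt 0) q && Theta (pt i) q).
  by move=> /(_ _ q) <- // q'; rewrite -E.
have Theta_shift i q : Theta (pt i) q = Theta (pt 0) (q - i).
  rewrite /Theta -track_map_shift; congr (track_map _ q == _).
  by apply/funext => q'; rewrite /ind /pt subr_eq0.
have flip1 S w : track_map (flip S w) = flip (Theta S) (track_map w).
  have := track_map_flipI S S w.
  have id S' w' : flip (fun q => S' q && S' q) w' = flip S' w'.
    by apply/funext => q; rewrite /flip andbb.
  by rewrite !id.
have [c Theta_c] : exists c, Theta (pt 0) c.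
  apply: contrapT => /forallNP no.
  have := flip1 (pt 0) (fun=> a0).
  have -> : flip (Theta (pt 0)) (track_map (fun=> a0)) = track_map (fun=> a0).
    by apply/funext => q; rewrite /flip; case: ifP => // /no.
  move=> /track_map_inj E.
  have := @flip_inj (pt 0) (fun=> false) (fun q => congr1 (@^~ q) E) 0.
  by rewrite /pt eqxx.
have Theta0 q : Theta (pt 0) q = (q == c).
  have [->//|qc] := eqVneq q c; apply/negbTE/negP => Tq.
  have := @dis (c - q) c; rewrite subr_eq0 eq_sym qc Theta_c Theta_shift /=.
  by rewrite opprB addrC subrK Tq => /(_ isT).
exists c => u i.
have := track_map_toffoli (u i) u (ind (pt i)) w0.
have -> : (fun q => if (u q == u i) && (ind (pt i) q == a1) then tau (w0 q) else w0 q)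
    = flip (pt i) w0.
  apply/funext => q; rewrite indE /flip /pt.
  by case: (eqVneq q i) => [->|_]; rewrite ?eqxx ?andbF.
rewrite flip1 w0E => /(congr1 (@^~ (i + c))).
rewrite /flip Theta_shift addrC addKr Theta0 eqxx.
rewrite /tau tpermL; case: ifP => [/andP[/eqP ->]//|_ E].
by case: a0a1.
Qed.

(** Finitely many maps with a centralizer made of shifts only: a finitary form of
the theorem of Ryan on the center of the automorphism group. *)
Theorem commuting_with_gates_is_shift : exists c, f = Shift n c.
Proof.
have [c cE] := track_map_is_shift; exists (- c * 3); apply: autinf_eqP => x.
apply: (@block_ext _ 2) => q; apply/ffunP => j; rewrite !ffunE ShiftE /shiftz.
have := f_trackwise x j q; rewrite /track => ->.
by rewrite -[q in LHS](subrK c) cE; congr x; lia.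
Qed.
End Tracks.

(** * Elements that virtually centralize the group *)

Lemma group_morph1 (G H : groupType) (f : G -> H) :
  (forall x y, f (x * y)%g = (f x * f y)%g) -> f 1%g = 1%g.
Proof. by move=> fM; apply: (monoid.mulgI (f 1%g)); rewrite -fM !monoid.mulg1. Qed.

Lemma group_morphX (G H : groupType) (f : G -> H) :
  (forall x y, f (x * y)%g = (f x * f y)%g) ->
  forall x k, f (x ^+ k)%g = (f x ^+ k)%g.
Proof.
move=> fM x; elim=> [|k IH]; first by rewrite !monoid.expg0 group_morph1.
by rewrite !monoid.expgS fM IH.
Qed.

Lemma expg_modn (G : groupType) (x : G) p k : (x ^+ p = 1)%g ->
  (x ^+ (k %% p) = x ^+ k)%g.
Proof.
move=> xp; rewrite {2}(divn_eq k p) monoid.expgnDr mulnC monoid.expgnA xp.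
by rewrite monoid.expg1n monoid.mul1g.
Qed.

Section Ghost.
Variable n : nat.

Lemma commuteX_mull (g h : autinf n) k j :
  (g ^+ k * h = h * g ^+ k)%g -> (g ^+ (k * j) * h = h * g ^+ (k * j))%g.
Proof.
move=> gh; rewrite monoid.expgnA.
exact: monoid.commute_sym (monoid.commuteX j (monoid.commute_sym gh)).
Qed.

Lemma Shift_inj : (2 <= n)%N -> injective (@Shift n).
Proof.
move=> hn c d E; pose a0 : 'I_n := Ordinal (ltnW hn); pose a1 : 'I_n := Ordinal hn.
have := congr1 (fun f : autinf n => f (fun i => if i == 0 then a1 else a0) (- c)) E.
rewrite !ShiftE /shiftz addNr eqxx; case: eqP => [|_ /(congr1 val)//].
by lia.
Qed.

(** Gates on blocks of length 3 and the shift of one track are finitely many, so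
one power of g commutes with all of them. *)
Lemma ghost_center_shift (g : autinf n) : (2 <= n)%N ->
  (forall h : autinf n, exists2 k, (0 < k)%N & (g ^+ k * h = h * g ^+ k)%g) ->
  exists k c, (0 < k)%N /\ (g ^+ k)%g = Shift n c.
Proof.
move=> hn gC.
have [k0 k0_gt0 gk0] := gC (Track_shift n ord0).
have [K KP] := choice (fun s : {perm {ffun 'I_3 -> 'I_n}} =>
  let: ex_intro2 k k0 gk := gC (gate s) in
  ex_intro (fun k => (0 < k)%N /\ (g ^+ k * gate s = gate s * g ^+ k)%g) k (conj k0 gk)).
pose k := (k0 * \prod_s K s)%N; exists k.
have kE s : k = (K s * (k0 * \prod_(t | t != s) K t))%N.
  by rewrite /k (bigD1 s) //= mulnCA.
have kgate (s : {perm {ffun 'I_3 -> 'I_n}}) : (g ^+ k * gate s = gate s * g ^+ k)%g.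
  by rewrite (kE s); apply: commuteX_mull; have [] := KP s.
have a01 : Ordinal (ltnW hn) <> Ordinal hn by move=> /(congr1 val).
have [|x|c cE] := @commuting_with_gates_is_shift n _ _ (g ^+ k)%g _ _ a01.
- by move=> s x; have := congr1 (fun f : autinf n => f x) (kgate s).
- exact: (congr1 (fun f : autinf n => f x) (commuteX_mull _ gk0)).
exists c; split => //; rewrite muln_gt0 k0_gt0 /=.
by apply: prodn_gt0 => s; have [] := KP s.
Qed.
End Ghost.

(** * Periodic points *)

Section Periodic.
Variable n : nat.
Local Notation X := (fullshift n).

Lemma autinf_comm_shift (F : autinf n) (c : int) :
  (F * Shift n c = Shift n c * F)%g -> forall x, F (shiftz c x) = shiftz c (F x).
Proof. by move=> E x; have := congr1 (fun f : autinf n => f x) E. Qed.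

Lemma shiftz_mul (x : X) (d : nat) (j : int) : shiftz d x = x -> shiftz (j * d%:Z) x = x.
Proof.
by move=> xd; have := @shift_comm_mulz n (fun=> x) d j (fun=> esym xd) x.
Qed.

(** The given periodic points are dense. *)
Lemma trivial_on_periodic (F : autinf n) (d : nat) : (0 < d)%N ->
  (forall j x, (0 < j)%N -> shiftz (j * d)%N x = x -> F x = x) -> F = 1%g.
Proof.
move=> d0 Fper; apply: autinf_eqP => x; rewrite autinf1E; apply/funext => i.
have [r Fr] := autinf_local F.
pose j := (2 * r).+1; pose M := (j * d)%N.
have M0 : (0 < M)%N by rewrite muln_gt0.
have Mr : (2 * r < M)%N by rewrite /M /j; nia.
pose y : X := shiftz (r%:Z - i) (periodic (win M.-1 (i - r%:Z) x)).
have xy (t : int) : i - r%:Z <= t < i - r%:Z + M%:Z -> x t = y t.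
  have /win_eq : win M.-1 (i - r%:Z) x = win M.-1 (i - r%:Z) y.
    rewrite win_shift (_ : i - r%:Z + (r%:Z - i) = 0); last by lia.
    by have := win_periodic 0 (win M.-1 (i - r%:Z) x); rewrite mul0r.
  by rewrite prednK // => H; exact: H.
rewrite (Fr x y) => [|t tr]; last by apply: xy; lia.
rewrite (Fper j) // ?xy //; first by lia.
rewrite -/M shiftzD addrC -shiftzD.
by have := periodic_shift (win M.-1 (i - r%:Z) x); rewrite prednK // => ->.
Qed.

(** Fixed points of F form a subshift of finite type for a power of the shift:
two equal windows of a fixed point at a large distance can be closed up into a
periodic point, which F still fixes by locality. *)
Lemma periodic_fixed_point (F : autinf n) x : F x = x ->
  exists d y, [/\ (0 < d)%N, shiftz d y = y & F y = y].
Proof.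
move=> Fx; have [r Fr] := autinf_local F; have [K K0 FK] := autinf_period F.
pose u := (K * (2 * r).+1)%N.
have Fsh (j : int) z : F (shiftz (j * K%:Z) z) = shiftz (j * K%:Z) (F z).
  exact: shift_comm_mulz.
pose v (i : 'I_(#|{: {ffun 'I_(2 * r).+1 -> 'I_n}}|.+1)) :=
  win (2 * r) ((i * u)%N%:Z - r%:Z) x.
have /injectivePn[i [i' ii' vv]] : ~~ injectiveb v.
  by apply/negP => /injectiveP /leq_card; rewrite card_ord ltnn.
wlog lt : i i' ii' vv / (i < i')%N.
  move=> H; have [|lt|/val_inj E] := ltngtP i i'; first exact: H.
    by apply: (H i' i) => //; rewrite eq_sym.
  by rewrite E eqxx in ii'.
(* move the first of the two equal windows to the origin *)
pose L := ((i' - i) * u)%N; pose x0 := shiftz (i * u)%N x.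
have u0 : (0 < u)%N by rewrite muln_gt0 K0.
have uE : u = ((2 * r).+1 * K)%N by rewrite mulnC.
have Lr : (2 * r < L)%N by rewrite /L /u; nia.
have Fx0 : F x0 = x0.
  rewrite /x0; have -> : (i * u)%N%:Z = (i * (2 * r).+1)%N%:Z * K%:Z by lia.
  by rewrite Fsh Fx.
have LE : L%:Z = ((i' - i) * (2 * r).+1)%N%:Z * K%:Z by rewrite /L uE; lia.
have x0L (t : int) : `|t| <= r%:Z -> x0 (t + L%:Z) = x0 t.
  move=> tr; rewrite /x0 /shiftz.
  have /win_eq/(_ (t + (i * u)%N%:Z)) : win (2 * r) ((i * u)%N%:Z - r%:Z) x =
      win (2 * r) ((i * u)%N%:Z - r%:Z) (shiftz L x).
    by rewrite win_shift; have := vv; rewrite /v => ->; congr (win _ _ x); rewrite /L; nia.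
  by rewrite /shiftz => -> //; [congr x; lia | lia].
pose y := periodic (win L.-1 0 x0).
have L0 : (0 < L)%N by lia.
have Ly : shiftz L y = y.
  by have := periodic_shift (win L.-1 0 x0); rewrite prednK.
have yx (t : int) : 0 <= t < L%:Z -> y t = x0 t.
  have /win_eq : win L.-1 0 y = win L.-1 0 x0.
    by have := win_periodic 0 (win L.-1 0 x0); rewrite mul0r.
  by rewrite prednK // add0r => H; exact: H.
have yx_wide (t : int) : - r%:Z <= t <= L%:Z + r%:Z -> y t = x0 t.
  move=> tr; have [t0|t0] := ltP t 0.
    have -> : y t = shiftz L y t by rewrite Ly.
    by rewrite /shiftz yx ?x0L //; lia.
  have [tL|tL] := ltP t L%:Z; first by apply: yx; rewrite t0 tL.
  have -> : y t = y (t - L%:Z) by rewrite -[in RHS]Ly /shiftz subrK.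
  rewrite yx; last by lia.
  by rewrite -x0L ?subrK //; lia.
exists L, y; split => //.
have FyL : shiftz L (F y) = F y by rewrite LE -Fsh -LE Ly.
have := periodic_win (m := L.-1); rewrite prednK // => pw.
rewrite -[RHS](pw _ _ Ly) -(pw _ _ FyL); congr periodic.
apply/win_eq => t; rewrite prednK // add0r => tL.
rewrite yx // -[in RHS]Fx0; apply: Fr => j jt; apply: yx_wide; lia.
Qed.
End Periodic.

(** * The action of gates on periodic points *)

Section Coarse.
Variable n : nat.
Local Notation X := (fullshift n).

Lemma gate_inj m : injective (@gate n m).
Proof.
move=> s t E; apply/permP => w.
have := win_gate s 0 (periodic w); rewrite -gateE E gateE win_gate.
by rewrite win_periodic.
Qed.

Lemma gateX m (s : {perm {ffun 'I_m.+1 -> 'I_n}}) k : gate (s ^+ k)%g = (gate s ^+ k)%g.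
Proof. by elim: k => [|k IH]; rewrite ?gate1 // expgSr gateM monoid.expgS IH. Qed.

Lemma gate_fun_window m (s : {ffun 'I_m.+1 -> 'I_n} -> {ffun 'I_m.+1 -> 'I_n})
    (M : nat) (x y : X) (q : int) : (m.+1 %| M.+1)%N ->
  win M (q * M.+1%:Z) x = win M (q * M.+1%:Z) y ->
  win M (q * M.+1%:Z) (gate_fun s x) = win M (q * M.+1%:Z) (gate_fun s y).
Proof.
case/dvdnP => j ME /win_eq xy; apply/win_eq => i iq; rewrite /gate_fun.
congr (s _ _); apply/win_eq => t tr; apply: xy.
have lt := ltn_ord (residue m i); have iE := block_decomp m i.
move: tr iE; rewrite /block_start; set b := (i %/ m.+1)%Z => tr iE.
rewrite ME PoszM mulrA in iq *.
set a := q * j%:Z in iq *.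
have m0 : 0 < m.+1%:Z :> int by [].
have ab : a <= b by rewrite -ltzD1 -(ltr_pM2r m0); lia.
have ba : b < a + j%:Z by rewrite -(ltr_pM2r m0); lia.
have : a * m.+1%:Z <= b * m.+1%:Z by rewrite ler_pM2r.
have : (b + 1) * m.+1%:Z <= (a + j%:Z) * m.+1%:Z by rewrite ler_pM2r // -ltzD1; lia.
by rewrite !mulrDl !mul1r; lia.
Qed.

(** A block of length M.+1 is a union of blocks of length m.+1, on which the gate
acts without looking outside. *)
Lemma gate_coarsen m M (s : {perm {ffun 'I_m.+1 -> 'I_n}}) : (m.+1 %| M.+1)%N ->
  exists t : {perm {ffun 'I_M.+1 -> 'I_n}}, gate t = gate s.
Proof.
move=> mM; pose f s' (w : {ffun 'I_M.+1 -> 'I_n}) := win M 0 (@gate_fun n m s' (periodic w)).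
have fE s' q x : win M (q * M.+1%:Z) (gate_fun s' x) = f s' (win M (q * M.+1%:Z) x).
  rewrite /f; have E : win M (q * M.+1%:Z) x =
      win M (q * M.+1%:Z) (periodic (win M (q * M.+1%:Z) x)) by rewrite win_periodic.
  rewrite (gate_fun_window s' mM E).
  set z := periodic _.
  have zq : shiftz (q * M.+1%:Z) z = z by apply: shiftz_mul; exact: periodic_shift.
  rewrite -[in RHS]zq; have [j Mj] := dvdnP mM.
  have -> : q * M.+1%:Z = (q * j%:Z) * m.+1%:Z by rewrite Mj PoszM mulrA.
  by rewrite (shift_comm_mulz _ (@gate_shift n m s')) win_shift add0r.
have f_inj : injective (f s).
  move=> w w' E.
  have ee : gate s (periodic w) = gate s (periodic w').
    apply: (@block_ext _ M) => q; rewrite !gateE !fE !win_periodic; exact: E.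
  apply: periodic_inj; have [[_ [g [_ fK _]]] _] := autinfP (gate s).
  exact: (can_inj fK).
exists (perm f_inj); apply: autinf_eqP => x; rewrite !gateE.
by apply: (@block_ext _ M) => q; rewrite win_gate fE permE.
Qed.

Definition periodic_action L (F : autinf n) (w : {ffun 'I_L.+1 -> 'I_n}) :=
  win L 0 (F (periodic w)).

Lemma periodic_actionK L F w : (F * Shift n L.+1 = Shift n L.+1 * F)%g ->
  periodic (@periodic_action L F w) = F (periodic w).
Proof.
move=> /autinf_comm_shift FL; apply: periodic_win.
by rewrite -FL periodic_shift.
Qed.

(** Maps that commute with the shift by L.+1 act on its fixed points, that is on
words of length L.+1, so G induces an action of the symmetric group on the words
of length m.+1 to which rigidity applies. The order reversal in the hypothesis is
cancelled by the one between maps and permutations. *)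
Lemma rigid_on_periodic (m L p : nat) (G : {perm {ffun 'I_m.+1 -> 'I_n}} -> autinf n)
    (pi : {perm {ffun 'I_m.+1 -> 'I_n}}) :
  (2 <= n)%N ->
  (forall s t, G (s * t)%g = (G t * G s)%g) ->
  (forall s, (G s * Shift n L.+1 = Shift n L.+1 * G s)%g) ->
  prime p -> (pi ^+ p = 1)%g -> (forall w, pi w != w) -> (p ^ 4 %| n ^ m.+1)%N ->
  (L <= m)%N ->
  (L < m)%N \/ (exists x, shiftz L.+1 x = x /\ G pi x = x) ->
  forall x, shiftz L.+1 x = x -> G pi x = x.
Proof.
move=> hn GM GL pp piX pif p4 Lm alt x xL.
have th_inj s : injective (periodic_action (L := L) (G s)).
  move=> w w' /(congr1 (@periodic n L)); rewrite !periodic_actionK // => E.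
  apply: periodic_inj; have [[_ [g [_ fK _]]] _] := autinfP (G s).
  exact: (can_inj fK).
pose theta s := perm (@th_inj s).
have thM s t : theta (s * t)%g = (theta s * theta t)%g.
  apply/permP => w; rewrite permM !permE; apply: (@periodic_inj n L).
  by rewrite !periodic_actionK // GM autinfME.
have cW k : #|{: {ffun 'I_k.+1 -> 'I_n}}| = (n ^ k.+1)%N.
  by rewrite card_ffun !card_ord.
have := free_perm_rigid pp piX pif _ thM; rewrite !cW => /(_ p4) th1.
have {}th1 : theta pi = 1%g.
  apply: th1; case: alt => [lt|[x0 [x0L x0F]]].
    apply: leq_ltn_trans (max_card _) _.
    by rewrite cW ltn_exp2l.
  apply: (@leq_trans (n ^ L.+1)); last by rewrite leq_exp2l.
  rewrite -cW -[X in (_ < X)%N]cardsT; apply/proper_card.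
  rewrite properE finset.subsetT /=; apply/subsetPn; exists (win L 0 x0) => //.
  rewrite inE negbK permE; apply/eqP/(@periodic_inj n L).
  by rewrite periodic_actionK // periodic_win.
rewrite -(periodic_win xL) -periodic_actionK //.
by have /permP/(_ (win L 0 x)) := th1; rewrite permE perm1 => ->.
Qed.

(** The case l < k shows that no embedding contracts the powers of the shift,
and the case l = k that it keeps free gates free. *)
Lemma embedding_rigid (Psi : autinf n -> autinf n) (k l m p : nat)
    (pi : {perm {ffun 'I_m.+1 -> 'I_n}}) :
  (2 <= n)%N -> (forall f g, Psi (f * g)%g = (Psi f * Psi g)%g) -> injective Psi ->
  (0 < k)%N -> (0 < l <= k)%N -> Psi (Shift n k) = Shift n l \/ Psi (Shift n k) = Shift n (- l%:Z) ->
  prime p -> (pi ^+ p = 1)%g -> (forall w, pi w != w) ->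
  (l < k)%N \/ (exists x, Psi (gate pi) x = x) -> False.
Proof.
move=> hn PM Pinj k0 /andP[l0 lk] Pk pp piX pif alt; set F := Psi (gate pi).
have P1 := group_morph1 PM.
have PX := group_morphX PM.
have [d [d0 alt']] : exists d, (0 < d)%N /\
    ((l < k)%N \/ exists2 x, shiftz d x = x & F x = x).
  case: alt => [|[x /periodic_fixed_point[d [y [d0 yd Fy]]]]].
    by exists 1%N; split => //; left.
  by exists d; split => //; right; exists y.
have pn : (p %| n)%N.
  have : (p %| n ^ m.+1)%N.
    have := free_perm_card pp piX pif; rewrite card_ffun !card_ord => ->.
    exact: dvdn_mulr.
  by rewrite Euclid_dvdX // => /andP[].
(* The factor 4 provides p ^ 4 in n ^ (k * e), the factor d makes the fixed point
   y have the period considered, and m.+1 makes pi a gate on the longer blocks. *)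
pose e := (4 * d * m.+1)%N.
have e0 : (0 < e)%N by rewrite !muln_gt0 d0.
suff F1 : F = 1%g.
  have E : pi = 1%g by apply: gate_inj; apply: Pinj; rewrite gate1 P1.
  have := pif [ffun=> Ordinal (ltnW hn)]; by rewrite E perm1 eqxx.
apply: (@trivial_on_periodic n F (l * e)); first by rewrite muln_gt0 l0.
move=> j x j0; pose E := (j * e)%N.
have E0 : (0 < E)%N by rewrite muln_gt0 j0.
have LE : (j * (l * e) = l * E)%N by rewrite mulnCA.
have ME1 : (k * E).-1.+1 = (k * E)%N by rewrite prednK // muln_gt0 k0.
have LE1 : (l * E).-1.+1 = (l * E)%N by rewrite prednK // muln_gt0 l0.
have [|t tE] := @gate_coarsen m (k * E).-1 pi.
  by rewrite ME1 /E /e; do 3 apply: dvdn_mull.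
have tX : (t ^+ p = 1)%g.
  by apply: gate_inj; rewrite gateX tE -gateX piX !gate1.
have tf w : t w != w.
  apply/eqP => tw.
  have : gate t (periodic w) = periodic w.
    rewrite gateE; apply: (@block_ext _ (k * E).-1) => q.
    by rewrite win_gate win_periodic.
  rewrite tE gateE => /(congr1 (win m (0 * m.+1%:Z))); rewrite win_gate.
  by move/eqP; apply/negP.
rewrite LE -LE1 => xL; rewrite /F -tE.
apply: (@rigid_on_periodic _ (l * E).-1 p (fun s => Psi (gate s)) t hn) => //.
- by move=> s s'; rewrite gateM PM.
- move=> s; have := congr1 Psi (gate_Shift_commute s); rewrite !PM ME1 LE1.
  have -> : Shift n (k * E)%N = (Shift n k ^+ E)%g by rewrite ShiftX.
  rewrite PX; case: Pk => ->; rewrite ShiftX //.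
  rewrite mulNr => C; apply: autinf_eqP => y; rewrite !autinfME.
  have {}C := autinf_comm_shift C; rewrite !ShiftE.
  have := C (shiftz (l * E)%N y); rewrite PoszM shiftzD addNr shiftz0 => ->.
  by rewrite shiftzD subrr shiftz0.
- have e4 : (4 <= k * E)%N.
    apply: dvdn_leq; first by rewrite muln_gt0 k0.
    by rewrite /E /e; do 2 apply: dvdn_mull; rewrite -mulnA dvdn_mulr.
  by rewrite ME1 -(subnKC e4) expnD dvdn_mulr // dvdn_exp2r.
- by rewrite -ltnS ME1 LE1 leq_pmul2r.
case: alt' => [lt|[y yd Fy]].
  by left; rewrite -ltnS ME1 LE1 ltn_pmul2r.
right; exists y; rewrite tE; split => //; rewrite LE1.
have -> : (l * E)%N%:Z = (l * (j * 4 * m.+1))%N%:Z * d%:Z by rewrite /E /e; lia.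
exact: shiftz_mul.
Qed.
End Coarse.

(** * Free elements of finite order are conjugate to gates *)

Section NormalForm.
Variable n : nat.
Local Notation X := (fullshift n).
Local Notation A := 'I_n.
(** Here r bounds the range of all the powers of q, windows of radius s separate
the points of every orbit of q, and the half blocks of length H are longer than
anything that can interact with a window of radius s. Points are cut at the
multiples of R = 2 H; the blocks of the final gate are centred at these cuts,
while the segments run from one cut to the next. *)
Variables (q : autinf n) (p r s H' : nat).
Let H := H'.+1.
Let m := (H' + H').+1.
Let R := m.+1.
Hypothesis p0 : (0 < p)%N.
Hypothesis qp : (q ^+ p = 1)%g.
Hypothesis q_local : forall i, local_rule r (q ^+ i)%g.
Hypothesis rs : (r <= s)%N.
Hypothesis sH : (s + r < H)%N.
Hypothesis q_R : forall x, q (shiftz R x) = shiftz R (q x).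
Hypothesis q_sep : forall x i, (0 < i < p)%N ->
  exists2 j : int, `|j| <= s%:Z & (q ^+ i)%g x j != x j.

Local Notation it i := (autinf_fun (q ^+ i)%g).
Local Notation V := {ffun 'I_p -> {ffun 'I_(2 * s).+1 -> A}}.

(** The window of the whole q-orbit of x at the cut 0. Its purpose is that past
and future become independent once it is given, compatibly with q; the window
of x alone would not determine the window of q x. *)
Definition label (x : X) : V := [ffun i : 'I_p => win (2 * s) (- s%:Z) (it i x)].
Definition lhalf (x : X) := win H' (- H%:Z) x.
Definition rhalf (x : X) := win H' 0 x.
Definition full (x : X) := win m (- H%:Z) x.

Lemma it_mod i x : it (i %% p)%N x = it i x.
Proof.
by rewrite (expg_modn i qp).
Qed.

Lemma itD i j x : it (i + j)%N x = it i (it j x).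
Proof. by rewrite monoid.expgnDr. Qed.

Lemma itS i x : it i.+1 x = q (it i x).
Proof. by rewrite monoid.expgS. Qed.

Lemma itSr i x : it i.+1 x = it i (q x).
Proof. by rewrite -addn1 itD monoid.expg1. Qed.

Lemma label_eq x y : label x = label y <->
  forall (i : nat) (j : int), `|j| <= s%:Z -> it i x j = it i y j.
Proof.
split=> [E i j js|E]; last first.
  apply/ffunP => i; rewrite !ffunE; apply/win_eq => j jr; apply: E; lia.
rewrite -(it_mod i x) -(it_mod i y).
have /ffunP/(_ (Ordinal (ltn_pmod i p0))) := E; rewrite !ffunE /= => /win_eq; apply.
by lia.
Qed.

Lemma label_it i x y : label x = label y -> label (it i x) = label (it i y).
Proof. by move=> /label_eq E; apply/label_eq => k j js; rewrite -!itD; exact: E. Qed.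

Lemma it_p x : it p x = x. Proof. by rewrite qp. Qed.

Lemma label_it_inj i x y : label (it i x) = label (it i y) -> label x = label y.
Proof.
have E z : it ((p - i %% p) + i)%N z = z.
  rewrite -it_mod -modnDmr subnK ?modnn; last by rewrite ltnW ?ltn_pmod.
  by [].
by move=> /(label_it (p - i %% p)); rewrite -!itD !E.
Qed.

Lemma full_eq x y : full x = full y <-> lhalf x = lhalf y /\ rhalf x = rhalf y.
Proof.
split=> [/win_eq E|[/win_eq E1 /win_eq E2]].
  by split; apply/win_eq => j jr; apply: E; rewrite /m /H in jr *; lia.
apply/win_eq => j jr; have [j0|j0] := ltP j 0; [apply: E1|apply: E2];
  by rewrite /m /H in jr *; lia.
Qed.

Lemma label_full x y : full x = full y -> label x = label y.
Proof.
move=> /win_eq E; apply/label_eq => i j js; apply: q_local => k kj; apply: E.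
by have := sH; rewrite /m /H; lia.
Qed.

Definition splice (x y : X) : X := fun j => if j < 0 then x j else y j.

(** Within distance s of the cut, x and y agree, so the two ranges on which q ^+ i
sees only x or only y overlap. *)
Lemma label_splice x y : label x = label y -> label (splice x y) = label x.
Proof.
move=> /label_eq E; apply/label_eq => i j js.
have Ex (k : int) : k <= s%:Z -> splice x y k = x k.
  rewrite /splice; case: ltP => // k0 ks; have := E 0%N k; rewrite !monoid.expg0 !autinf1E.
  by move=> -> //; lia.
have Ey (k : int) : - s%:Z <= k -> splice x y k = y k.
  rewrite /splice; case: ltP => // k0 ks; have := E 0%N k; rewrite !monoid.expg0 !autinf1E.
  by move=> -> //; lia.
have [j0|j0] := ltP j 0.
  by apply: q_local => k kj; apply: Ex; lia.
by rewrite E //; apply: q_local => k kj; apply: Ey; lia.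
Qed.

Lemma lhalf_splice x y : lhalf (splice x y) = lhalf x.
Proof. by apply/win_eq => j jr; rewrite /splice; case: ltP => //; rewrite /H in jr; lia. Qed.

Lemma rhalf_splice x y : rhalf (splice x y) = rhalf y.
Proof. by apply/win_eq => j jr; rewrite /splice; case: ltP => //; lia. Qed.

(** All that the images under powers of q of the segment between the cuts 0
and R depend on. *)
Definition seg (x y : X) := [/\ label x = label y, label (shiftz R x) = label (shiftz R y),
  rhalf x = rhalf y & lhalf (shiftz R x) = lhalf (shiftz R y)].

Lemma seg_window x y : seg x y <-> [/\ label x = label y, label (shiftz R x) = label (shiftz R y) &
  forall j : int, 0 <= j < R%:Z -> x j = y j].
Proof.
split=> [[l1 l2 /win_eq E1 /win_eq E2]|[l1 l2 E]].
  split=> // j jr; have [jH|jH] := ltP j H%:Z.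
    by apply: E1; rewrite /H in jH; lia.
  have := E2 (j - R%:Z); rewrite /shiftz !subrK; apply.
  by rewrite /R /m /H in jr jH *; lia.
split=> //; apply/win_eq => j jr; first by apply: E; rewrite /R /m; lia.
by rewrite /shiftz; apply: E; rewrite /R /m /H in jr *; lia.
Qed.

Lemma it_R i x : it i (shiftz R x) = shiftz R (it i x).
Proof.
elim: i x => [|i IH] x; first by rewrite monoid.expg0 !autinf1E.
by rewrite -addn1 !itD monoid.expg1 q_R IH.
Qed.

(** Near the two ends the image is given by the labels, and in the middle by
locality. *)
Lemma seg_it i x y : seg x y -> seg (it i x) (it i y).
Proof.
move=> /seg_window[l1 l2 E]; apply/seg_window; split.
- exact: label_it.
- by rewrite -!it_R; exact: label_it.
move=> j jr; have [js|js] := leP j s%:Z.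
  by move/label_eq: l1; apply; lia.
have [jR|jR] := leP (R%:Z - s%:Z) j.
  move/label_eq: l2 => /(_ i (j - R%:Z)); rewrite !it_R /shiftz !subrK; apply; lia.
by apply: q_local => k kj; apply: E; lia.
Qed.

Definition right_halves (w : V) : pred {ffun 'I_H'.+1 -> A} :=
  fun a => `[< exists x, label x = w /\ rhalf x = a >].
Definition left_halves (w : V) : pred {ffun 'I_H'.+1 -> A} :=
  fun a => `[< exists x, label x = w /\ lhalf x = a >].

Lemma right_halves_mem x : right_halves (label x) (rhalf x).
Proof. by apply: asboolT; exists x. Qed.

Lemma left_halves_mem x : left_halves (label x) (lhalf x).
Proof. by apply: asboolT; exists x. Qed.

(** Independence of past and future given the label. *)
Lemma halves_point w a b : left_halves w a -> right_halves w b ->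
  exists x, [/\ label x = w, lhalf x = a & rhalf x = b].
Proof.
move=> /asboolP[x [lx <-]] /asboolP[y [ly <-]]; exists (splice x y).
by rewrite lhalf_splice rhalf_splice label_splice ?lx.
Qed.

Lemma segment_point w a u b : right_halves w a -> left_halves u b ->
  exists x, [/\ label x = w, rhalf x = a, label (shiftz R x) = u & lhalf (shiftz R x) = b].
Proof.
move=> /asboolP[x [lx ax]] /asboolP[y [ly ay]].
pose z : X := fun j => if j < H%:Z then x j else y (j - R%:Z).
have zx : full z = full x.
  by apply/win_eq => j jr; rewrite /z ifT //; move: jr; rewrite /m /H; lia.
have zy : full (shiftz R z) = full y.
  apply/win_eq => j jr; rewrite /shiftz /z ifF; first by congr y; rewrite addrK.
  by rewrite /R /m /H in jr *; lia.
exists z; split; first by rewrite (label_full zx).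
- by have [_ ->] := (full_eq z x).1 zx.
- by rewrite (label_full zy).
- by have [-> _] := (full_eq _ y).1 zy.
Qed.

Local Notation half := {ffun 'I_H'.+1 -> A}.

Lemma it_predK x : it p.-1 (q x) = x.
Proof. by rewrite -[in RHS](it_p x) -[in RHS](prednK p0) -addn1 itD monoid.expg1. Qed.

Lemma label_q x y : label x = label y -> label (q x) = label (q y).
Proof. by move=> /(label_it 1); rewrite monoid.expg1. Qed.

Definition segment_data := [pred t : (V * half) * (V * half) |
  right_halves t.1.1 t.1.2 && left_halves t.2.1 t.2.2].

(** By [seg_it] q acts on segments; f is this action, on the data that the
counting below takes apart. It is injective since q ^+ p.-1 inverts it. *)
Lemma segment_map : exists f, [/\ {in segment_data &, injective f},
  forall t, t \in segment_data -> f t \in segment_data,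
  forall t x, t \in segment_data -> label x = t.1.1 -> (f t).1.1 = label (q x) &
  forall t x, t \in segment_data -> label x = t.2.1 -> (f t).2.1 = label (q x)].
Proof.
have [[x0]|nX] := pselect (inhabited X); last first.
  exists id; split=> // t x; by case: nX.
have pick t : exists z, t \in segment_data -> [/\ label z = t.1.1, rhalf z = t.1.2,
    label (shiftz R z) = t.2.1 & lhalf (shiftz R z) = t.2.2].
  have [/andP[ta tb]|] := boolP (t \in segment_data); last by exists x0.
  by have [z zP] := segment_point ta tb; exists z.
have [g gP] := choice pick.
pose f t := ((label (q (g t)), rhalf (q (g t))),
             (label (shiftz R (q (g t))), lhalf (shiftz R (q (g t))))).
exists f; split.
- move=> t t' tD t'D [E0 E1 E2 E3].
  have [l1 r1 l2 r2] := gP _ tD; have [l1' r1' l2' r2'] := gP _ t'D.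
  have /(seg_it p.-1) : seg (q (g t)) (q (g t')) by split.
  rewrite !it_predK => -[e0 e1 e2 e3].
  have {e0} : t.1.1 = t'.1.1 by rewrite -l1 -l1'.
  have {e2} : t.1.2 = t'.1.2 by rewrite -r1 -r1'.
  have {e1} : t.2.1 = t'.2.1 by rewrite -l2 -l2'.
  have {e3} : t.2.2 = t'.2.2 by rewrite -r2 -r2'.
  by clear; case: t t' => [[w a] [u b]] [[w' a'] [u' b']] /= -> -> -> ->.
- by move=> t _; rewrite !inE /= right_halves_mem left_halves_mem.
- by move=> t x /gP[l1 _ _ _] lx; apply: label_q; rewrite l1.
- by move=> t x /gP[_ _ l2 _] lx; rewrite /= -q_R; apply: label_q; rewrite l2.
Qed.

(** The segments with a given left label are the product of the half blocks that
may follow it with all the pairs of a right label and a half block that may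
precede it. The second factor is the same for every left label and q is
injective on segments, so the first factor cannot decrease. The right half
blocks are treated in the same way. *)
Lemma card_halves x : (#|right_halves (label x)| <= #|right_halves (label (q x))|)%N /\
  (#|left_halves (label x)| <= #|left_halves (label (q x))|)%N.
Proof.
have [f [f_inj f_dom f1 f2]] := segment_map.
pose Rs := [pred t : V * half | right_halves t.1 t.2].
pose Ls := [pred t : V * half | left_halves t.1 t.2].
have Rs0 : (0 < #|Rs|)%N.
  by apply/card_gt0P; exists (label x, rhalf x); exact: right_halves_mem.
have Ls0 : (0 < #|Ls|)%N.
  by apply/card_gt0P; exists (label x, lhalf x); exact: left_halves_mem.
have cR w : (#|right_halves w| * #|Ls|)%N = #|[predI segment_data & [pred t | t.1.1 == w]]|.
  have -> : #|right_halves w| = #|[predX pred1 w & right_halves w]| by rewrite cardX card1 mul1n.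
  rewrite -cardX; apply: eq_card => -[[w' a] [u b]].
  rewrite !inE /=; rewrite [w' == w]eq_sym; case: eqP => [->|]; rewrite ?andbT ?andbF //.
have cL w : (#|Rs| * #|left_halves w|)%N = #|[predI segment_data & [pred t | t.2.1 == w]]|.
  have -> : #|left_halves w| = #|[predX pred1 w & left_halves w]| by rewrite cardX card1 mul1n.
  rewrite -cardX; apply: eq_card => -[[w' a] [u b]].
  rewrite !inE /=; case: eqP => [->|]; rewrite ?andbT ?andbF //.
have le (P Q : pred _) : (forall t, t \in segment_data -> P t -> Q (f t)) ->
    (#|[predI segment_data & P]| <= #|[predI segment_data & Q]|)%N.
  move=> PQ; have inj : {in [predI segment_data & P] &, injective f}.
    by move=> t t' /andP[tD _] /andP[t'D _]; exact: f_inj.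
  rewrite -(card_in_image inj); apply: subset_leq_card.
  apply/fintype.subsetP => t0 /fintype.imageP [t /andP[tD tP] ->].
  by rewrite inE /= f_dom //=; exact: PQ.
split.
  rewrite -(leq_pmul2r Ls0) !cR; apply: le => t tD /= /eqP E.
  by rewrite (f1 t x).
rewrite -(leq_pmul2l Rs0) !cL; apply: le => t tD /= /eqP E.
by rewrite (f2 t x).
Qed.

(** The inequalities close up along the orbit of length p. *)
Lemma card_halves_eq x : #|right_halves (label (q x))| = #|right_halves (label x)| /\
  #|left_halves (label (q x))| = #|left_halves (label x)|.
Proof.
have le i y : (#|right_halves (label y)| <= #|right_halves (label (it i y))|)%N /\
  (#|left_halves (label y)| <= #|left_halves (label (it i y))|)%N.
  elim: i => [|i [IH1 IH2]]; first by rewrite monoid.expg0.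
  have [h1 h2] := card_halves (it i y).
  by rewrite itS; split; [exact: leq_trans h1|exact: leq_trans h2].
have [] := le p.-1 (q x); rewrite it_predK => h1 h2.
have [h3 h4] := card_halves x.
by split; apply/eqP; rewrite eqn_leq ?h1 ?h2.
Qed.

(** A block is determined by its label and the ranks of its two halves among the
possible ones; by [card_halves_eq] the ranks can be kept while q changes the
label. *)
Definition ridx x := index (rhalf x) (enum (right_halves (label x))).
Definition lidx x := index (lhalf x) (enum (left_halves (label x))).

Lemma index_enum_inj (P : pred half) a b : P a -> P b ->
  index a (enum P) = index b (enum P) -> a = b.
Proof.
move=> Pa Pb E; rewrite -[a](nth_index a (s := enum P)) ?mem_enum //.
by rewrite E nth_index ?mem_enum.
Qed.

Lemma ridx_inj x y : label x = label y -> ridx x = ridx y -> rhalf x = rhalf y.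
Proof.
rewrite /ridx => E; rewrite -E; apply: index_enum_inj; first exact: right_halves_mem.
by rewrite E; exact: right_halves_mem.
Qed.

Lemma lidx_inj x y : label x = label y -> lidx x = lidx y -> lhalf x = lhalf y.
Proof.
rewrite /lidx => E; rewrite -E; apply: index_enum_inj; first exact: left_halves_mem.
by rewrite E; exact: left_halves_mem.
Qed.

Lemma code_inj x y : label x = label y -> ridx x = ridx y -> lidx x = lidx y ->
  full x = full y.
Proof. by move=> E R1 L1; apply/full_eq; split; [exact: lidx_inj|exact: ridx_inj]. Qed.

Lemma code_full x y : full x = full y -> ridx x = ridx y /\ lidx x = lidx y.
Proof.
move=> E; have [L1 R1] := (full_eq x y).1 E.
by rewrite /ridx /lidx R1 L1 (label_full E).
Qed.

Lemma index_transfer (P Q : pred half) a : P a -> #|Q| = #|P| ->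
  exists2 b, Q b & index b (enum Q) = index a (enum P).
Proof.
move=> Pa QP; have lt : (index a (enum P) < size (enum Q))%N.
  by rewrite -cardE QP cardE index_mem mem_enum.
exists (nth a (enum Q) (index a (enum P))); last by rewrite index_uniq ?enum_uniq.
by have := mem_nth a lt; rewrite mem_enum.
Qed.

Lemma gate_target x : exists y, [/\ label y = label (q x), ridx y = ridx x & lidx y = lidx x].
Proof.
have [cR cL] := card_halves_eq x.
have [b rb Eb] := index_transfer (right_halves_mem x) cR.
have [a la Ea] := index_transfer (left_halves_mem x) cL.
have [y [ly ay by_]] := halves_point la rb.
by exists y; rewrite /ridx /lidx ly ay by_.
Qed.

Definition target x := projT1 (cid (gate_target x)).

Lemma targetP x :
  [/\ label (target x) = label (q x), ridx (target x) = ridx x & lidx (target x) = lidx x].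
Proof. exact: projT2 (cid (gate_target x)). Qed.

Definition centred c : X := shiftz H (periodic (m := m) c).

Lemma full_centred c : full (centred c) = c.
Proof. by rewrite /full win_shift addNr; have := win_periodic 0 c; rewrite mul0r. Qed.

Lemma target_inj : injective (fun c => full (target (centred c))).
Proof.
move=> c c' E; rewrite -(full_centred c) -(full_centred c').
have [l1 r1 i1] := targetP (centred c); have [l2 r2 i2] := targetP (centred c').
have [Er El] := code_full E; have El' := label_full E.
apply: code_inj; last 2 first.
- by rewrite -r1 -r2.
- by rewrite -i1 -i2.
apply: (@label_it_inj 1); rewrite monoid.expg1; by rewrite -l1 -l2.
Qed.

Definition block_perm : {perm {ffun 'I_m.+1 -> A}} := perm target_inj.

(** The blockwise counterpart of q: it changes labels as q does and keeps the
ranks. The conjugation by a shift places the blocks around the cuts. *)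
Definition psi : autinf n := (Shift n H * gate block_perm * Shift n (- H%:Z))%g.

Lemma psiE x : psi x = shiftz H (gate block_perm (shiftz (- H%:Z) x)).
Proof. by []. Qed.

Lemma psi_R x : psi (shiftz R x) = shiftz R (psi x).
Proof.
have E : shiftz (- H%:Z) (shiftz R x) = shiftz R (shiftz (- H%:Z) x).
  by rewrite !shiftzD addrC.
by rewrite !psiE E gateE gate_shift !shiftzD addrC.
Qed.

Lemma full_psi x : full (psi x) = block_perm (full x).
Proof.
rewrite psiE /full win_shift addNr gateE.
have := win_gate block_perm 0 (shiftz (- H%:Z) x); rewrite mul0r => ->.
by rewrite win_shift add0r.
Qed.

Lemma psi_code x :
  [/\ label (psi x) = label (q x), ridx (psi x) = ridx x & lidx (psi x) = lidx x].
Proof.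
have E : full (psi x) = full (target x).
  have [l1 r1 i1] := targetP x; have [l2 r2 i2] := targetP (centred (full x)).
  have F : full x = full (centred (full x)) by rewrite full_centred.
  have [Fr Fl] := code_full F; have Fv := label_full F.
  rewrite full_psi permE; apply: code_inj.
  - by rewrite l1 l2; apply: label_q.
  - by rewrite r1 r2.
  - by rewrite i1 i2.
have [l1 r1 i1] := targetP x; have [Er El] := code_full E.
by rewrite (label_full E) Er El.
Qed.

Lemma psiXS i x : (psi ^+ i.+1)%g x = psi ((psi ^+ i)%g x).
Proof. by rewrite monoid.expgS. Qed.

Lemma psiX_R i x : (psi ^+ i)%g (shiftz R x) = shiftz R ((psi ^+ i)%g x).
Proof.
elim: i => [|i IH]; first by rewrite monoid.expg0.
by rewrite !psiXS IH psi_R.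
Qed.

Lemma label_psiX i x : label ((psi ^+ i)%g x) = label (it i x).
Proof.
elim: i => [|i IH]; first by rewrite monoid.expg0.
rewrite psiXS itS; have [-> _ _] := psi_code ((psi ^+ i)%g x).
exact: label_q.
Qed.

(** After p steps the labels are back and the ranks have not moved. *)
Lemma psi_p : (psi ^+ p = 1)%g.
Proof.
have fullp x : full ((psi ^+ p)%g x) = full x.
  have idx i : ridx ((psi ^+ i)%g x) = ridx x /\ lidx ((psi ^+ i)%g x) = lidx x.
    elim: i => [|i [IHr IHl]]; first by rewrite monoid.expg0.
    by rewrite psiXS; have [_ -> ->] := psi_code ((psi ^+ i)%g x).
  by have [Er El] := idx p; apply: code_inj => //; rewrite label_psiX it_p.
apply: autinf_eqP => x; rewrite autinf1E.
have E : shiftz (- H%:Z) ((psi ^+ p)%g x) = shiftz (- H%:Z) x.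
  apply: (@block_ext _ m) => b; rewrite !win_shift.
  have := fullp (shiftz (b * R%:Z) x).
  by rewrite (shift_comm_mulz _ (psiX_R p)) /full !win_shift addrC.
have := congr1 (shiftz H) E; by rewrite !shiftzD subrr !shiftz0.
Qed.

Lemma seg_psi x y : seg x y -> seg (psi x) (psi y).
Proof.
move=> [l1 l2 r1 r2].
have [lx rx ix] := psi_code x; have [ly ry iy] := psi_code y.
have [lx' rx' ix'] := psi_code (shiftz R x); have [ly' ry' iy'] := psi_code (shiftz R y).
have lab1 : label (psi x) = label (psi y) by rewrite lx ly; exact: label_q.
have lab2 : label (psi (shiftz R x)) = label (psi (shiftz R y)).
  by rewrite lx' ly'; exact: label_q.
split; rewrite -?psi_R //.
  by apply: ridx_inj => //; rewrite rx ry /ridx r1 l1.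
by apply: lidx_inj => //; rewrite ix' iy' /lidx r2 l2.
Qed.

(** Freeness enters here: windows of distinct points of an orbit differ. *)
Lemma label_neq x (i j : 'I_p) : (i < j)%N -> label x i <> label x j.
Proof.
move=> ij; rewrite !ffunE => /win_eq E.
have [|k ks /eqP[]] := @q_sep (it i x) (j - i)%N.
  by rewrite subn_gt0 ij (leq_ltn_trans (leq_subr _ _)).
by rewrite -itD subnK ?(ltnW ij) // E //; lia.
Qed.

Lemma label_ord_inj x : injective (label x).
Proof.
move=> i j E; apply: val_inj; have [lt|lt|//] := ltngtP i j.
  by case: (label_neq lt E).
by case: (label_neq lt (esym E)).
Qed.

(** A continuous cocycle for the cyclic action of q: the place of the smallest
window in the orbit. The windows are distinct, so q lowers it by one modulo
p. *)
Definition phase (w : V) : nat := [arg min_(i < Ordinal p0) enum_rank (w i)].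

Lemma phase_q x : ((phase (label (q x))).+1 = phase (label x) %[mod p])%N.
Proof.
rewrite /phase; case: arg_minnP => // a _ amin; case: arg_minnP => // b _ bmin.
have shE (i : 'I_p) : label (q x) i = label x (Ordinal (ltn_pmod i.+1 p0)).
  rewrite !ffunE /= -it_mod -[in RHS]it_mod modn_mod.
  by rewrite !it_mod itSr.
have aE := amin (Ordinal (ltn_pmod (b + p.-1) p0)) isT.
have bE := bmin (Ordinal (ltn_pmod a.+1 p0)) isT.
rewrite !shE in aE.
have modE : Ordinal (ltn_pmod (Ordinal (ltn_pmod (b + p.-1) p0)).+1 p0) = b.
  apply: val_inj => /=; rewrite -addn1 modnDml -addnA addn1 prednK //.
  by rewrite modnDr modn_small.
rewrite modE in aE.
have : enum_rank (label x b) = enum_rank (label x (Ordinal (ltn_pmod a.+1 p0))).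
  by apply: val_inj; apply/eqP; rewrite eqn_leq bE aE.
move=> /enum_rank_inj /label_ord_inj -> /=.
by rewrite modn_mod.
Qed.

(** Maps that keep all the labels and act independently on the segments. Labels
being kept, different maps can be used on different segments. *)
Definition segment_local (F : autinf n) := [/\ forall x, label (F x) = label x,
  forall x y, seg x y -> seg (F x) (F y) & forall x, F (shiftz R x) = shiftz R (F x)].

Definition glue (Th : nat -> autinf n) (x : X) : X :=
  fun i => Th (phase (label (shiftz (block_start m i) x))) x i.

Lemma glue_block Th x (b i : int) : b * R%:Z <= i < (b + 1) * R%:Z ->
  glue Th x i = Th (phase (label (shiftz (b * R%:Z) x))) x i.
Proof.
move=> ib; rewrite /glue; congr (autinf_fun (Th (phase (label (shiftz _ x)))) x i).
pose d := i - b * R%:Z.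
have lt : (`|d| < m.+1)%N by rewrite -/R /d; lia.
have := @block_start_block m b (Ordinal lt) => /=.
have -> // : b * m.+1%:Z + `|d|%N%:Z = i by rewrite -/R /d; lia.
Qed.

Section Glue.
Variable Th : nat -> autinf n.
Hypothesis ThP : forall k, segment_local (Th k).

Lemma glue_R x : glue Th (shiftz R x) = shiftz R (glue Th x).
Proof.
apply/funext => i; have [_ _ ThR] := ThP (phase (label (shiftz (block_start m i) (shiftz R x)))).
rewrite {1}/glue ThR /shiftz; rewrite (@glue_block _ _ ((i %/ m.+1)%Z + 1)).
  congr (autinf_fun (Th (phase (label _))) _ _); apply/funext => j; rewrite /shiftz.
  by congr x; rewrite /block_start -/R; lia.
have := block_decomp m i; have := ltn_ord (residue m i).
by rewrite /block_start -/R => lt ->; rewrite !mulrDl mul1r; move: lt; rewrite /R; lia.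
Qed.

(** The two segments that meet at the cut may be transformed by different maps,
but both keep the label, so past and future can be spliced. *)
Lemma label_glue x : label (glue Th x) = label x.
Proof.
pose k1 := phase (label (shiftz (-1 * R%:Z) x)); pose k2 := phase (label (shiftz (0 * R%:Z) x)).
have [l1 _ _] := ThP k1; have [l2 _ _] := ThP k2.
rewrite -[RHS](l1 x) -(@label_splice (Th k1 x) (Th k2 x)); last by rewrite l1 l2.
apply: label_full; apply/win_eq => j jr; rewrite /splice.
have [j0|j0] := ltP j 0.
  by rewrite (@glue_block _ _ (-1)) //; move: jr; rewrite /R /m /H; lia.
by rewrite (@glue_block _ _ 0) //; move: jr; rewrite /R /m /H; lia.
Qed.

Lemma seg_glue x : seg (glue Th x) (Th (phase (label x)) x).
Proof.
have [l1 _ ThR] := ThP (phase (label x)).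
apply/seg_window; split; first by rewrite label_glue l1.
  by rewrite -glue_R -ThR label_glue l1.
move=> j jr; rewrite (@glue_block _ _ 0) ?mul0r ?shiftz0 // add0r mul1r.
exact: jr.
Qed.

Lemma glue_local : exists d, local_rule d (glue Th).
Proof.
have [rr rrP] := choice (fun k => autinf_local (Th k)).
pose M := (\max_(w : V) rr (phase w))%N.
exists (M + R + s + r)%N => x y i xy; rewrite /glue.
have bi := block_decomp m i; have ri := ltn_ord (residue m i).
have -> : label (shiftz (block_start m i) x) = label (shiftz (block_start m i) y).
  apply/label_eq => k j js; apply: q_local => l lj; rewrite /shiftz; apply: xy.
  by move: ri bi; rewrite -/R; lia.
set w := label _; apply: (rrP (phase w)) => j ji; apply: xy.
have wM : (rr (phase w) <= M)%N by apply: (@leq_bigmax V (fun w => rr (phase w)) w).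
by lia.
Qed.
End Glue.

Lemma seg_ext x y : (forall b : int, seg (shiftz (b * R%:Z) x) (shiftz (b * R%:Z) y)) -> x = y.
Proof.
move=> E; apply: (@block_ext _ m) => b.
have /seg_window[_ _ Eb] := E b; apply/win_eq => j jb.
have := Eb (j - b * R%:Z); rewrite /shiftz !subrK; apply.
by move: jb; rewrite -/R; lia.
Qed.

Lemma seg_trans x y z : seg x y -> seg y z -> seg x z.
Proof. by move=> [a b c d] [a' b' c' d']; split; eapply etrans; eassumption. Qed.

Lemma seg_sym x y : seg x y -> seg y x.
Proof. by move=> [a b c d]; split; exact: esym. Qed.

Lemma glueK (Th Th' : nat -> autinf n) : (forall k, segment_local (Th k)) ->
  (forall k, segment_local (Th' k)) -> (forall k, (Th k * Th' k = 1)%g) ->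
  cancel (glue Th') (glue Th).
Proof.
move=> ThP ThP' ThK x; apply: seg_ext => b.
have sh F : (forall k, segment_local (F k)) ->
    forall y, glue F (shiftz (b * R%:Z) y) = shiftz (b * R%:Z) (glue F y).
  by move=> FP y; apply: shift_comm_mulz; exact: glue_R.
rewrite -!sh //; set z := shiftz _ x.
apply: seg_trans (seg_glue ThP _) _; rewrite (label_glue ThP').
have [_ segT _] := ThP (phase (label z)).
have := segT _ _ (seg_glue ThP' z); rewrite -autinfME ThK.
by [].
Qed.

(** Both maps are written with nonnegative powers: the exponent p.-1 * k stands
for - k. *)
Let straighten k := (psi ^+ (p.-1 * k) * q ^+ k)%g.
Let bend k := (q ^+ (p.-1 * k) * psi ^+ k)%g.

Lemma predp_cancel (F : autinf n) k : (F ^+ p = 1)%g -> (F ^+ (p.-1 * k) * F ^+ k = 1)%g.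
Proof.
by move=> Fp; rewrite -monoid.expgnDr addnC -mulSn prednK // monoid.expgnA Fp monoid.expg1n.
Qed.

Lemma predp_cancelr (F : autinf n) k : (F ^+ p = 1)%g -> (F ^+ k * F ^+ (p.-1 * k) = 1)%g.
Proof.
by move=> Fp; rewrite -monoid.expgnDr -mulSn prednK // monoid.expgnA Fp monoid.expg1n.
Qed.

Lemma seg_psiX k x y : seg x y -> seg ((psi ^+ k)%g x) ((psi ^+ k)%g y).
Proof.
move=> xy; elim: k => [|k IH]; first by rewrite monoid.expg0.
by rewrite !psiXS; exact: seg_psi.
Qed.

Lemma straighten_local k : segment_local (straighten k).
Proof.
split.
- move=> x; rewrite /straighten autinfME label_psiX -itD addnC -mulSn prednK // monoid.expgnA.
  by rewrite qp monoid.expg1n.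
- by move=> x y xy; rewrite /straighten !autinfME; apply: seg_psiX; exact: seg_it.
- by move=> x; rewrite /straighten !autinfME it_R psiX_R.
Qed.

Lemma bend_local k : segment_local (bend k).
Proof.
split.
- move=> x; rewrite /bend autinfME; have /(label_it (p.-1 * k)) -> := label_psiX k x.
  rewrite -itD addnC -mulSn prednK // monoid.expgnA.
  by rewrite qp monoid.expg1n.
- by move=> x y xy; rewrite /bend !autinfME; apply: seg_it; exact: seg_psiX.
- by move=> x; rewrite /bend !autinfME psiX_R it_R.
Qed.

Lemma straightenK k : (straighten k * bend k = 1)%g.
Proof.
rewrite /straighten /bend monoid.mulgA -(monoid.mulgA _ (q ^+ k)%g) predp_cancelr //.
by rewrite monoid.mulg1 predp_cancel // psi_p.
Qed.

Lemma bendK k : (bend k * straighten k = 1)%g.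
Proof.
rewrite /straighten /bend monoid.mulgA -(monoid.mulgA _ (psi ^+ k)%g) predp_cancelr ?psi_p //.
by rewrite monoid.mulg1 predp_cancel.
Qed.

Lemma glue_is_autinf : is_autinf (glue straighten).
Proof.
have [r1 l1] := glue_local straighten; have [r2 l2] := glue_local bend.
apply: (@local_is_autinf _ r1 r2 _ (glue bend) R) => //.
- exact: (glueK bend_local straighten_local bendK).
- exact: (glueK straighten_local bend_local straightenK).
- by move=> x; apply: glue_R; exact: straighten_local.
Qed.

Definition conjugacy : autinf n := Autinf (asboolT glue_is_autinf).

(** On a segment of phase k the conjugacy is psi ^- k composed with q ^+ k. For
q z the phase is k - 1, and psi ^- (k - 1) composed with q ^+ k is psi after
the conjugacy. *)
Lemma conjugacy_q x : conjugacy (q x) = psi (conjugacy x).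
Proof.
apply: seg_ext => b.
have sh y : glue straighten (shiftz (b * R%:Z) y) = shiftz (b * R%:Z) (glue straighten y).
  by apply: shift_comm_mulz => z; apply: glue_R; exact: straighten_local.
rewrite -(shift_comm_mulz b psi_R) -[conjugacy (q x)]/(glue straighten (q x)).
rewrite -[conjugacy x]/(glue straighten x) -!sh -(shift_comm_mulz b q_R); set z := shiftz _ x.
apply: seg_trans (seg_glue straighten_local _) _.
apply: seg_trans; last by apply: seg_psi; apply/seg_sym; exact: (seg_glue straighten_local z).
suff -> : straighten (phase (label (q z))) (q z) = psi (straighten (phase (label z)) z) by split.
have Tmod a c : (a = c %[mod p])%N -> straighten a = straighten c.
  move=> ac; rewrite /straighten -(expg_modn (_ * a) psi_p) -(expg_modn a qp) -modnMmr ac modnMmr.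
  by rewrite (expg_modn _ psi_p) (expg_modn _ qp).
rewrite -(Tmod _ _ (phase_q z)); set k := phase _.
have straightenE j y : straighten j y = (psi ^+ (p.-1 * j))%g (it j y) by [].
rewrite !straightenE -psiXS itSr mulnS -addSn prednK //.
by rewrite monoid.expgnDr psi_p monoid.mul1g.
Qed.

End NormalForm.

Local Open Scope card_scope.

(** * Free elements are preserved by automorphisms *)

Section Final.
Variable n : nat.
Local Notation X := (fullshift n).

Lemma local_ruleW r r' (f : X -> X) : (r <= r')%N -> local_rule r f -> local_rule r' f.
Proof. by move=> rr lf x y i xy; apply: lf => j ji; apply: xy; lia. Qed.

(** By compactness: points moved only outside larger and larger windows cluster
at a fixed point. *)
Lemma free_separation (F : autinf n) : (forall x, F x <> x) ->
  exists s : nat, forall x, exists2 j : int, `|j| <= s%:Z & F x j != x j.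
Proof.
move=> Ff; apply: contrapT => /forallNP H.
have {}H s : exists x : X, forall j : int, `|j| <= s%:Z -> F x j = x j.
  have /existsNP[x nx] := H s; exists x => j js; apply/eqP/negPn/negP => ne.
  by apply: nx; exists j.
have [u uP] := choice H; have [x xP] := fullshift_cluster u.
have [r Fr] := autinf_local F.
apply: (Ff x); apply/funext => i.
have [m mi xm] := xP (`|i| + r)%N `|i|%N.
rewrite -(xm i); last by lia.
rewrite -(uP m); last by lia.
by apply: Fr => j ji; rewrite xm //; lia.
Qed.

Theorem free_normal_form (q : autinf n) (p : nat) : (0 < p)%N -> (q ^+ p = 1)%g ->
  (forall x i, (0 < i < p)%N -> (q ^+ i)%g x <> x) ->
  exists m (pi : {perm {ffun 'I_m.+1 -> 'I_n}}) (h : autinf n),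
    (h * q = gate pi * h)%g.
Proof.
move=> p0 qp qf.
have [rr rrP] := choice (fun i => autinf_local (q ^+ i)%g).
pose r := (\max_(i < p) rr i)%N.
have q_local i : local_rule r (q ^+ i)%g.
  rewrite -(expg_modn i qp).
  apply: local_ruleW (rrP _).
  exact: (@leq_bigmax _ (fun i : 'I_p => rr i) (Ordinal (ltn_pmod i p0))).
have sepi i : exists s : nat, (0 < i < p)%N -> forall x,
    exists2 j : int, `|j| <= s%:Z & (q ^+ i)%g x j != x j.
  have [ip|_] := boolP (0 < i < p)%N; last by exists 0%N.
  by have [s sP] := free_separation (fun x => qf x i ip); exists s.
have [ss ssP] := choice sepi.
pose s := (r + \max_(i < p) ss i)%N.
have q_sep x i : (0 < i < p)%N -> exists2 j : int, `|j| <= s%:Z & (q ^+ i)%g x j != x j.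
  move=> ip; have [j js jx] := ssP i ip x; exists j => //.
  have /andP[_ ltip] := ip.
  have : (ss i <= \max_(i < p) ss i)%N.
    exact: (@leq_bigmax _ (fun i : 'I_p => ss i) (Ordinal ltip)).
  by rewrite /s; lia.
have [K K0 qK] := autinf_period q.
pose H' := (K * (s + r).+1).-1.
have HE : H'.+1 = (K * (s + r).+1)%N by rewrite prednK // muln_gt0 K0.
have rs : (r <= s)%N by exact: leq_addr.
have sH : (s + r < H'.+1)%N by rewrite HE leq_pmull.
have q_R x : q (shiftz (H' + H').+2 x) = shiftz (H' + H').+2 (q x).
  have -> : (H' + H').+2%:Z = (2 * (s + r).+1)%N%:Z * K%:Z by lia.
  exact: shift_comm_mulz.
exists (H' + H').+1, (block_perm p0 qp q_local rs sH q_R).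
exists (Shift n (- H'.+1%:Z) * conjugacy p0 qp q_local rs sH q_R)%g.
apply: autinf_eqP => x; rewrite !autinfME (conjugacy_q _ _ _ _ _ _ q_sep) psiE ShiftE.
by rewrite shiftzD addNr shiftz0.
Qed.

Lemma gate_free m (pi : {perm {ffun 'I_m.+1 -> 'I_n}}) :
  (forall x, gate pi x <> x) -> forall w, pi w != w.
Proof.
move=> gf w; apply/eqP => piw; apply: (gf (periodic w)).
by rewrite gateE; apply: (@block_ext _ m) => b; rewrite win_gate win_periodic.
Qed.

(** Whichever of Psi and its inverse does not expand the powers of the shift
gives the contradiction; in the expanding case no fixed point is needed. *)
Lemma prime_order_free (Psi Psi' : autinf n -> autinf n) (q : autinf n) (p : nat) :
  (2 <= n)%N -> (forall f g, Psi (f * g)%g = (Psi f * Psi g)%g) ->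
  cancel Psi Psi' -> cancel Psi' Psi ->
  prime p -> (q ^+ p = 1)%g -> (forall x i, (0 < i < p)%N -> (q ^+ i)%g x <> x) ->
  forall x, Psi q x <> x.
Proof.
move=> hn PM PK P'K pp qp qf x Px.
have P'M f g : Psi' (f * g)%g = (Psi' f * Psi' g)%g.
  by rewrite -{1}(P'K f) -{1}(P'K g) -PM PK.
have P1 := group_morph1 PM.
have PX := group_morphX PM.
have [m [pi [h hq]]] := free_normal_form (prime_gt0 pp) qp qf.
have hqX i : (h * q ^+ i = gate pi ^+ i * h)%g.
  elim: i => [|i IH]; first by rewrite !monoid.expg0 monoid.mulg1 monoid.mul1g.
  by rewrite !monoid.expgS monoid.mulgA hq -monoid.mulgA IH monoid.mulgA.
have piX : (pi ^+ p = 1)%g.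
  apply: gate_inj; rewrite gateX gate1; apply: (monoid.mulIg h).
  by rewrite -hqX qp monoid.mulg1 monoid.mul1g.
have pif : forall w, pi w != w.
  apply: gate_free => y gy; have := qf ((h^-1)%g y) 1%N; rewrite prime_gt1 //.
  move=> /(_ isT); rewrite monoid.expg1; apply.
  have [g hg] : exists g, cancel h g by exists (h^-1)%g; exact: autinfVK.
  apply: (can_inj hg); rewrite -[LHS]autinfME hq autinfME -[h (_ y)]autinfME.
  by rewrite monoid.mulgV autinf1E.
have Pgate : exists y, Psi (gate pi) y = y.
  exists (Psi h x); rewrite -autinfME -PM -hq PM autinfME.
  by rewrite Px.
have [k [c [k0 Pk]]] : exists k c, (0 < k)%N /\ (Psi (Shift n 1) ^+ k)%g = Shift n c.
  apply: ghost_center_shift => // f.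
  have [k k0 fk] := autinf_period (Psi' f); exists k => //.
  rewrite -PX ShiftX mul1r -[f]P'K -!PM; congr Psi.
  by apply: autinf_eqP => y; rewrite !autinfME !ShiftE fk.
rewrite -PX ShiftX mul1r in Pk.
have c0 : c != 0.
  apply/eqP => c0; have : Shift n k = Shift n 0.
    apply: (can_inj PK); rewrite Pk c0.
    have -> : Shift n 0 = 1%g by apply: autinf_eqP => y; rewrite ShiftE shiftz0.
    by rewrite P1.
  by move/(Shift_inj hn); lia.
pose l := `|c|%N; have l0 : (0 < l)%N by rewrite /l; lia.
have Pk' : Psi (Shift n k) = Shift n l \/ Psi (Shift n k) = Shift n (- l%:Z).
  rewrite Pk; have [cp|cn] := leP 0 c; [left|right]; congr Shift; rewrite /l; lia.
have [lk|kl] := leqP l k.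
  apply: (embedding_rigid hn PM (can_inj PK) k0 _ Pk' pp piX pif); first by rewrite l0.
  by move: lk; rewrite leq_eqVlt => /orP[/eqP->|->]; [right|left].
apply: (@embedding_rigid _ Psi' l k m p pi hn P'M (can_inj P'K) l0 _ _ pp piX pif).
- by rewrite k0 ltnW.
- case: Pk' => Pl; first by left; rewrite -Pl PK.
  right; apply: (can_inj PK); rewrite P'K.
  apply: (monoid.mulIg (Shift n (- l%:Z))); rewrite -{2}Pl -PM -!ShiftD addrN addNr.
  have -> : Shift n 0 = 1%g by apply: autinf_eqP => y; rewrite ShiftE shiftz0.
  by rewrite P1.
by left.
Qed.

Lemma pow_fix_gcd (F : autinf n) a b x : (0 < a)%N -> (F ^+ a)%g x = x ->
  (F ^+ b)%g x = x -> (F ^+ gcdn a b)%g x = x.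
Proof.
move=> a0 Fa Fb.
have FM e j : (F ^+ e)%g x = x -> (F ^+ (j * e))%g x = x.
  move=> Fe; elim: j => [|j IH]; first by rewrite monoid.expg0.
  by rewrite mulSn monoid.expgnDr autinfME IH.
case: (egcdnP b a0) => km kn E _.
by have := FM _ km Fa; rewrite E addnC monoid.expgnDr autinfME FM.
Qed.

Lemma cyclic_orbitE (F : autinf n) k x : (0 < k)%N -> (F ^+ k = 1)%g ->
  cyclic_orbit F x = [set (F ^+ m)%g x | m in [set: nat]].
Proof.
move=> k0 Fk; apply/seteqP; split=> y; last by left.
case=> // -[m _ <-]; exists (k.-1 * m)%N => //; congr (autinf_fun _ x).
apply: (monoid.mulIg (F ^+ m)%g); rewrite monoid.mulVg -monoid.expgnDr addnC -mulSn.
by rewrite prednK // monoid.expgnA Fk monoid.expg1n.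
Qed.

Lemma pow_modn (F : autinf n) k m x : (F ^+ k)%g x = x -> (F ^+ (m %% k))%g x = (F ^+ m)%g x.
Proof.
move=> Fk; rewrite [in RHS](divn_eq m k) addnC monoid.expgnDr autinfME.
suff -> : (F ^+ (m %/ k * k))%g x = x by [].
elim: (m %/ k)%N => [|j IH]; first by rewrite monoid.expg0.
by rewrite mulSn monoid.expgnDr autinfME IH Fk.
Qed.

(** An orbit of a map of order k is enumerated by the exponents below k, and a
return before k enumerates it by fewer of them. *)
Lemma orbit_card_free (F : autinf n) k x : (0 < k)%N -> (F ^+ k = 1)%g ->
  cyclic_orbit F x #= `I_k <-> forall i, (0 < i < k)%N -> (F ^+ i)%g x <> x.
Proof.
move=> k0 Fk; rewrite (cyclic_orbitE x k0 Fk); split=> [card i /andP[i0 ik] Fi|free].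
  have : `I_k #<= `I_i.
    apply: card_le_trans (card_image_le (fun m => (F ^+ m)%g x) `I_i).
    rewrite -(card_le_eql card); apply: subset_card_le => _ [m _ <-].
    by exists (m %% i)%N; rewrite /= ?ltn_pmod ?pow_modn.
  by rewrite card_le_II leqNgt ik.
have -> : [set (F ^+ m)%g x | m in [set: nat]] = (fun m => (F ^+ m)%g x) @` `I_k.
  apply/seteqP; split=> [_ [m _ <-]|_ [m _ <-]]; last by exists m.
  by exists (m %% k)%N; rewrite /= ?ltn_pmod ?pow_modn // Fk.
apply: inj_card_eq => a b; rewrite !inE /= => ak bk.
have sep c d : (c < d)%N -> (d < k)%N -> (F ^+ c)%g x <> (F ^+ d)%g x.
  move=> cd dk; rewrite -(subnKC (ltnW cd)) monoid.expgnDr autinfME => E.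
  apply: (free (d - c)%N); first by rewrite subn_gt0 cd (leq_ltn_trans (leq_subr _ _)).
  exact/esym/(can_inj (autinfVK (F ^+ c)%g)).
by move=> E; have [lt|lt|//] := ltngtP a b; [case: (sep _ _ lt bk)|case: (sep _ _ lt ak)].
Qed.
End Final.

Local Close Scope ring_scope.

Theorem corollary6p1 (n : nat) (hn : (2 <= n)%N)
    (Psi : {multiplicative autinf n -> autinf n}) (hPsi : bijective Psi)
    (k : nat) (phi : autinf n) (hphi : has_order phi k)
    (horb : forall x : fullshift n, cyclic_orbit phi x #= `I_k) :
  has_order (Psi phi) k /\
  (forall x : fullshift n, cyclic_orbit (Psi phi) x #= `I_k).
Proof.
have [k0 phik kmin] := hphi; have [Psi' PK P'K] := hPsi.
have PM f g : Psi (f * g)%g = (Psi f * Psi g)%g by exact: gmulfM.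
have P1 := group_morph1 PM; have PX := group_morphX PM.
have Pphik : (Psi phi ^+ k = 1)%g by rewrite -PX phik P1.
have free x : forall i, (0 < i < k)%N -> (phi ^+ i)%g x <> x.
  exact/(orbit_card_free x k0 phik).
split.
  split=> // m m0 Pm; apply: kmin => //; apply: (can_inj PK).
  by rewrite PX Pm P1.
move=> x; apply/(orbit_card_free x k0 Pphik) => i /andP[i0 ik] Px.
(* A power of phi of prime order p that is a power of phi ^+ j, so that its image
   still fixes x. *)
pose j := gcdn i k.
have j0 : (0 < j)%N by rewrite gcdn_gt0 i0.
have Pj : (Psi phi ^+ j)%g x = x by apply: pow_fix_gcd => //; rewrite Pphik.
have jk : (j %| k)%N := dvdn_gcdr i k.
have d1 : (1 < k %/ j)%N.
  by rewrite ltn_divRL // mul1n (leq_ltn_trans (dvdn_leq i0 (dvdn_gcdl i k))).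
pose p := pdiv (k %/ j); have pp : prime p := pdiv_prime d1.
have pk : (p %| k)%N.
  by rewrite (dvdn_trans (pdiv_dvd _)) // -{2}(divnK jk) dvdn_mulr.
have kpE : (k %/ p = j * (k %/ j %/ p))%N.
  by rewrite muln_divA ?pdiv_dvd // mulnC divnK.
apply: (@prime_order_free n Psi Psi' (phi ^+ (k %/ p))%g p hn _ PK P'K pp _ _ x).
- exact: PM.
- by rewrite -monoid.expgnA divnK.
- move=> y a /andP[a0 ap]; rewrite -monoid.expgnA; apply: free.
  have kp0 : (0 < k %/ p)%N by rewrite divn_gt0 ?prime_gt0 // dvdn_leq.
  by rewrite muln_gt0 kp0 a0 /= -{2}(divnK pk) ltn_pmul2l.
rewrite PX kpE monoid.expgnA.
elim: (_ %/ p)%N => [|e IH]; first by rewrite monoid.expg0.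
by rewrite monoid.expgS autinfME IH.
Qed.
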